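(* Let $\mathcal{A}$ and $\mathcal{B}$ be abelian categories with enough projective and enough injective objects, let $T:\mathcal{B}\to\mathcal{A}$ be a right exact covariant functor and $G:\mathcal{A}\to\mathcal{B}$ a left exact covariant functor, let $\mathcal{X},\mathcal{M}$ be classes of objects in $\mathcal{A}$ and $\mathcal{Y},\mathcal{N}$ classes of objects in $\mathcal{B}$, and let $n\geqslant 1$ be an integer. (1) Assume that $\left(\begin{pmatrix}\mathcal{X}\\ \mathcal{Y}\end{pmatrix},\mathfrak{D}_{\mathcal{N}}^{\mathcal{M}}\right)$ is a hereditary left $n$-cotorsion pair in the comma category $(\mathcal{B}\downarrow G)$. (a) If $(\mathrm{R}^jG)M=0$ for each $1\leqslant j\leqslant n$ and any $M\in\mathcal{M}$, then $(\mathcal{X},\mathcal{M})$ is a hereditary left $n$-cotorsion pair in $\mathcal{A}$. (b) If $(\mathrm{R}^jG)M=0$ for each $1\leqslant j\leqslant n$ and any $M\in\mathcal{M}$, $\mathcal{N}_{n-1}^{\wedge}$ is closed under extensions and $G(X)\in\mathcal{N}_{n-1}^{\wedge}$ for any $X\in\mathcal{X}$, then $(\mathcal{Y},\mathcal{N})$ is a hereditary left $n$-cotorsion pair in $\mathcal{B}$. (2) Assume that $\left(\mathfrak{B}_{\mathcal{Y}}^{\mathcal{X}},\begin{pmatrix}\mathcal{M}\\ \mathcal{N}\end{pmatrix}\right)$ is a hereditary right $n$-cotorsion pair in the comma category $(T\downarrow\mathcal{A})$. (a) If $(\mathrm{L}_jT)Y=0$ for each $1\leqslant j\leqslant n$ and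 any $Y\in\mathcal{Y}$, then $(\mathcal{Y},\mathcal{N})$ is a hereditary right $n$-cotorsion pair in $\mathcal{B}$. (b) If $(\mathrm{L}_jT)Y=0$ for each $1\leqslant j\leqslant n$ and any $Y\in\mathcal{Y}$, $\mathcal{X}_{n-1}^{\vee}$ is closed under extensions and $T(N)\in\mathcal{X}_{n-1}^{\vee}$ for any $N\in\mathcal{N}$, then $(\mathcal{X},\mathcal{M})$ is a hereditary right $n$-cotorsion pair in $\mathcal{A}$.
   Context: All classes of objects in $\mathcal{A}$ and $\mathcal{B}$ contain the zero object and are closed under isomorphisms. Comma categories. Objects of $(T\downarrow\mathcal{A})$ are triples $\begin{pmatrix}A\\ B\end{pmatrix}_{\varphi}$ with $A\in\mathcal{A}$, $B\in\mathcal{B}$, $\varphi:T(B)\to A$; morphisms to $\begin{pmatrix}A'\\ B'\end{pmatrix}_{\varphi'}$ are pairs $(a:A\to A',\,b:B\to B')$ with $\varphi' T(b)=a\varphi$. Objects of $(\mathcal{B}\downarrow G)$ are triples $\begin{pmatrix}A\\ B\end{pmatrix}_{\phi}$ with $\phi:B\to G(A)$; morphisms are pairs $(a,b)$ with $\phi' b=G(a)\phi$. Both are abelian, and a sequence in either is exact iff it is exact in both components. Classes. $\begin{pmatrix}\mathcal{P}\\ \mathcal{Q}\end{pmatrix}$ is the class of objects of the comma category in question with first component in $\mathcal{P}$ and second component in $\mathcal{Q}$. $\mathfrak{B}_{\mathcal{Y}}^{\mathcal{X}}$ is the class of $\begin{pmatrix}X\\ Y\end{pmatrix}_{\varphi}\in(T\downarrow\mathcal{A})$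 with $Y\in\mathcal{Y}$, $\varphi$ a monomorphism and $\mathrm{Coker}\,\varphi\in\mathcal{X}$. $\mathfrak{D}_{\mathcal{N}}^{\mathcal{M}}$ is the class of $\begin{pmatrix}M\\ N\end{pmatrix}_{\phi}\in(\mathcal{B}\downarrow G)$ with $M\in\mathcal{M}$, $\phi$ an epimorphism and $\mathrm{Ker}\,\phi\in\mathcal{N}$. $\mathrm{L}_jT$ and $\mathrm{R}^jG$ are the $j$-th left, resp. right, derived functors. For a class $\mathcal{C}$ of objects of an abelian category and $m\geqslant 0$: $\mathcal{C}_m^{\wedge}$ is the class of objects $A$ admitting an exact sequence $0\to C_k\to\cdots\to C_0\to A\to 0$ with all $C_i\in\mathcal{C}$ and some $k\leqslant m$; $\mathcal{C}_m^{\vee}$ is the class of objects $A$ admitting an exact sequence $0\to A\to C^0\to\cdots\to C^k\to 0$ with all $C^i\in\mathcal{C}$ and some $k\leqslant m$. A pair $(\mathcal{C},\mathcal{D})$ of classes of objects in an abelian category is a left $n$-cotorsion pair if (i) $\mathcal{C}$ is closed under direct summands, (ii) $\mathrm{Ext}^i(C,D)=0$ for all $1\leqslant i\leqslant n$, $C\in\mathcal{C}$, $D\in\mathcal{D}$, and (iii) every object $A$ admits a short exact sequence $0\to K\to C\to A\to 0$ with $C\in\mathcal{C}$, $K\in\mathcal{D}_{n-1}^{\wedge}$. It is a right $n$-cotorsion pair if (i') $\mathcal{D}$ is closed under direct summands, (ii) holds, and (iii') every object $A$ admits a short exact sequence $0\to A\to D\to K\to 0$ with $D\in\mathcal{D}$,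 $K\in\mathcal{C}_{n-1}^{\vee}$. A left or right $n$-cotorsion pair $(\mathcal{C},\mathcal{D})$ is hereditary if $\mathrm{Ext}^{n+1}(C,D)=0$ for all $C\in\mathcal{C}$, $D\in\mathcal{D}$. *)

(* Defs.v *)
(* MathComp with classical axioms (mathcomp.classical.boolp). *)
From HB Require Import structures.
From mathcomp Require Import all_boot all_order all_algebra.
From mathcomp Require Import boolp.
From Stdlib Require Import Relation_Operators.

Set Implicit Arguments.
Unset Strict Implicit.
Unset Printing Implicit Defensive.

Import GRing.Theory.
Local Open Scope ring_scope.

(** * Abelian categories *)

Record preadditive := Preadditive {
  Ob :> Type;
  Hom : Ob -> Ob -> zmodType;
  idm : forall X, Hom X X;
  comp : forall X Y Z, Hom Y Z -> Hom X Y -> Hom X Z;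
  comp1m : forall X Y (f : Hom X Y), comp (idm Y) f = f;
  compm1 : forall X Y (f : Hom X Y), comp f (idm X) = f;
  compmA : forall W X Y Z (h : Hom Y Z) (g : Hom X Y) (f : Hom W X),
    comp h (comp g f) = comp (comp h g) f;
  compDl : forall X Y Z (g g' : Hom Y Z) (f : Hom X Y),
    comp (g + g') f = comp g f + comp g' f;
  compDr : forall X Y Z (g : Hom Y Z) (f f' : Hom X Y),
    comp g (f + f') = comp g f + comp g f'
}.

Arguments idm {p} X.
Arguments comp {p X Y Z}.
Notation "g ∘ f" := (comp g f) (at level 40, left associativity).

Section Preadditive.
Variable C : preadditive.
Implicit Types X Y Z W K : C.

Definition mono X Y (f : Hom X Y) :=
  forall W (u v : Hom W X), f ∘ u = f ∘ v -> u = v.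

Definition epi X Y (f : Hom X Y) :=
  forall W (u v : Hom Y W), u ∘ f = v ∘ f -> u = v.

Definition isomorphic X Y :=
  exists (f : Hom X Y) (g : Hom Y X), g ∘ f = idm X /\ f ∘ g = idm Y.

Definition is_zero X :=
  forall Y, (forall f g : Hom X Y, f = g) /\ (forall f g : Hom Y X, f = g).

Definition is_kernel X Y (f : Hom X Y) K (k : Hom K X) :=
  f ∘ k = 0 /\
  forall W (h : Hom W X), f ∘ h = 0 -> exists! u : Hom W K, k ∘ u = h.

Definition is_cokernel X Y (f : Hom X Y) K (c : Hom Y K) :=
  c ∘ f = 0 /\
  forall W (h : Hom Y W), h ∘ f = 0 -> exists! u : Hom K W, u ∘ c = h.

Definition is_biproduct X Y S (i1 : Hom X S) (i2 : Hom Y S)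
    (p1 : Hom S X) (p2 : Hom S Y) :=
  [/\ p1 ∘ i1 = idm X, p2 ∘ i2 = idm Y, p1 ∘ i2 = 0, p2 ∘ i1 = 0
    & i1 ∘ p1 + i2 ∘ p2 = idm S].

Definition projective (P : C) :=
  forall X Y (p : Hom X Y) (f : Hom P Y), epi p ->
    exists g : Hom P X, p ∘ g = f.

Definition injective_ob (I : C) :=
  forall X Y (i : Hom X Y) (f : Hom X I), mono i ->
    exists g : Hom Y I, g ∘ i = f.

Definition enough_projectives :=
  forall X, exists (P : C) (p : Hom P X), projective P /\ epi p.

Definition enough_injectives :=
  forall X, exists (I : C) (i : Hom X I), injective_ob I /\ mono i.

Lemma comp0m X Y Z (f : Hom X Y) : (0 : Hom Y Z) ∘ f = 0.
Proof. by apply: (addrI (0 ∘ f)); rewrite -compDl !addr0. Qed.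

Lemma compm0 X Y Z (g : Hom Y Z) : g ∘ (0 : Hom X Y) = 0.
Proof. by apply: (addrI (g ∘ 0)); rewrite -compDr !addr0. Qed.

Lemma compNl X Y Z (g : Hom Y Z) (f : Hom X Y) : (- g) ∘ f = - (g ∘ f).
Proof. by apply: (addrI (g ∘ f)); rewrite -compDl !subrr comp0m. Qed.

Lemma compNr X Y Z (g : Hom Y Z) (f : Hom X Y) : g ∘ (- f) = - (g ∘ f).
Proof. by apply: (addrI (g ∘ f)); rewrite -compDr !subrr compm0. Qed.

Lemma mono0P X Y (f : Hom X Y) :
  (forall W (u : Hom W X), f ∘ u = 0 -> u = 0) -> mono f.
Proof.
move=> h W u v e; apply/subr0_eq/h.
by rewrite compDr compNr e subrr.
Qed.

Lemma epi0P X Y (f : Hom X Y) :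
  (forall W (u : Hom Y W), u ∘ f = 0 -> u = 0) -> epi f.
Proof.
move=> h W u v e; apply/subr0_eq/h.
by rewrite compDl compNl e subrr.
Qed.

Lemma kernel_mono X Y (f : Hom X Y) K (k : Hom K X) : is_kernel f k -> mono k.
Proof.
move=> [e h] W u v euv.
have [w [_ hw]] : exists! u, k ∘ u = k ∘ v by apply: h; rewrite compmA e comp0m.
by rewrite -(hw u euv) -(hw v erefl).
Qed.

Lemma cokernel_epi X Y (f : Hom X Y) K (c : Hom Y K) : is_cokernel f c -> epi c.
Proof.
move=> [e h] W u v euv.
have [w [_ hw]] : exists! u, u ∘ c = v ∘ c by apply: h; rewrite -compmA e compm0.
by rewrite -(hw u euv) -(hw v erefl).
Qed.

Lemma is_kernelI X Y (f : Hom X Y) K (k : Hom K X) : f ∘ k = 0 -> mono k ->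
  (forall W (h : Hom W X), f ∘ h = 0 -> exists u : Hom W K, k ∘ u = h) ->
  is_kernel f k.
Proof.
move=> e km h; split=> // W g /h [u eu]; exists u; split=> // v ev.
by apply: km; rewrite eu ev.
Qed.

Lemma is_cokernelI X Y (f : Hom X Y) K (c : Hom Y K) : c ∘ f = 0 -> epi c ->
  (forall W (h : Hom Y W), h ∘ f = 0 -> exists u : Hom K W, u ∘ c = h) ->
  is_cokernel f c.
Proof.
move=> e km h; split=> // W g /h [u eu]; exists u; split=> // v ev.
by apply: km; rewrite eu ev.
Qed.

End Preadditive.

Record abelian := Abelian {
  apre :> preadditive;
  zob : apre;
  zobP : is_zero zob;
  bip : apre -> apre -> apre;
  bin1 : forall X Y, Hom X (bip X Y);
  bin2 : forall X Y, Hom Y (bip X Y);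
  bpr1 : forall X Y, Hom (bip X Y) X;
  bpr2 : forall X Y, Hom (bip X Y) Y;
  bipP : forall X Y, is_biproduct (bin1 X Y) (bin2 X Y) (bpr1 X Y) (bpr2 X Y);
  ker : forall (X Y : apre) (f : Hom X Y), apre;
  kermap : forall (X Y : apre) (f : Hom X Y), Hom (ker f) X;
  kermapP : forall (X Y : apre) (f : Hom X Y), is_kernel f (kermap f);
  coker : forall (X Y : apre) (f : Hom X Y), apre;
  cokermap : forall (X Y : apre) (f : Hom X Y), Hom Y (coker f);
  cokermapP : forall (X Y : apre) (f : Hom X Y), is_cokernel f (cokermap f);
  mono_normal : forall (X Y : apre) (f : Hom X Y), mono f ->
    exists (Z : apre) (g : Hom Y Z), is_kernel g f;
  epi_normal : forall (X Y : apre) (f : Hom X Y), epi f ->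
    exists (Z : apre) (g : Hom Z X), is_cokernel g f
}.

Arguments zob {a}.
Arguments bip {a}.

Section Exactness.
Variable C : abelian.
Implicit Types X Y Z W K : C.

Definition ker_lift W X Y (g : Hom X Y) (f : Hom W X) (e : g ∘ f = 0) :
  Hom W (ker g) := projT1 (cid (proj2 (kermapP g) W f e)).

Definition coker_desc X Y W (f : Hom X Y) (g : Hom Y W) (e : g ∘ f = 0) :
  Hom (coker f) W := projT1 (cid (proj2 (cokermapP f) W g e)).

Lemma ker_liftE W X Y (g : Hom X Y) (f : Hom W X) (e : g ∘ f = 0) :
  kermap g ∘ ker_lift e = f.
Proof. by rewrite /ker_lift; case: cid => u []. Qed.

Lemma coker_descE X Y W (f : Hom X Y) (g : Hom Y W) (e : g ∘ f = 0) :
  coker_desc e ∘ cokermap f = g.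
Proof. by rewrite /coker_desc; case: cid => u []. Qed.

Lemma kermap0 X Y (f : Hom X Y) : f ∘ kermap f = 0.
Proof. exact: (proj1 (kermapP f)). Qed.

Lemma cokermap0 X Y (f : Hom X Y) : cokermap f ∘ f = 0.
Proof. exact: (proj1 (cokermapP f)). Qed.

Lemma kermap_mono X Y (f : Hom X Y) : mono (kermap f).
Proof. exact: (kernel_mono (kermapP f)). Qed.

Lemma cokermap_epi X Y (f : Hom X Y) : epi (cokermap f).
Proof. exact: (cokernel_epi (cokermapP f)). Qed.

(* Ker g / Im f, the quotient being the cokernel of the map X -> Ker g induced
   by f. *)
Definition homology X Y Z (f : Hom X Y) (g : Hom Y Z) (e : g ∘ f = 0) : C :=
  coker (ker_lift e).

Definition exact X Y Z (f : Hom X Y) (g : Hom Y Z) :=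
  exists e : g ∘ f = 0, epi (ker_lift e).

Definition short_exact X Y Z (f : Hom X Y) (g : Hom Y Z) :=
  [/\ exact (0 : Hom zob X) f, exact f g & exact g (0 : Hom Z zob)].

Lemma exact_ker X Y Z K (f : Hom X Y) (g : Hom Y Z) (k : Hom K Y) (p : Hom X K) :
  is_kernel g k -> epi p -> k ∘ p = f -> exact f g.
Proof.
move=> hk hp ef.
have e : g ∘ f = 0 by rewrite -ef compmA (proj1 hk) comp0m.
exists e => W u v euv.
have [t [et _]] := proj2 hk _ _ (kermap0 g).
have e1 : ker_lift (proj1 hk) ∘ t = idm _.
  by apply: (@kermap_mono _ _ g); rewrite compmA ker_liftE et compm1.
have e2 : ker_lift (proj1 hk) ∘ p = ker_lift e.
  by apply: (@kermap_mono _ _ g); rewrite compmA !ker_liftE.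
have : (u ∘ ker_lift (proj1 hk)) = (v ∘ ker_lift (proj1 hk)).
  by apply: hp; rewrite -!compmA e2.
by move/(congr1 (fun x => x ∘ t)); rewrite -!compmA e1 !compm1.
Qed.

Lemma epi_exact0 X Y (f : Hom X Y) : epi f -> exact f (0 : Hom Y zob).
Proof.
move=> hf; apply: (@exact_ker _ _ _ _ _ _ (idm Y) f) => //; last by rewrite comp1m.
split=> [|W h _]; first by rewrite comp0m.
by exists h; split=> [|v]; rewrite comp1m.
Qed.

Lemma exact0_epi X Y (f : Hom X Y) : exact f (0 : Hom Y zob) -> epi f.
Proof.
case=> e he W u v euv.
have [t [et _]] := proj2 (kermapP (0 : Hom Y zob)) _ (idm Y) (comp0m _ _).
have : u ∘ kermap (0 : Hom Y zob) = v ∘ kermap (0 : Hom Y zob).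
  by apply: he; rewrite -!compmA ker_liftE.
by move/(congr1 (fun x => x ∘ t)); rewrite -!compmA et !compm1.
Qed.

Lemma mono_exact0 X Y (f : Hom X Y) : mono f -> exact (0 : Hom zob X) f.
Proof.
move=> hf; have e : f ∘ (0 : Hom zob X) = 0 by rewrite compm0.
exists e => W u v _.
suff k0 : idm (ker f) = 0 by rewrite -(compm1 u) -(compm1 v) k0 !compm0.
apply: (@kermap_mono _ _ f); apply: hf.
by rewrite compm1 compm0 kermap0 compm0.
Qed.

Lemma exact0_mono X Y (f : Hom X Y) : exact (0 : Hom zob X) f -> mono f.
Proof.
case=> e he; apply: mono0P => W u eu.
have k0 : kermap f = 0.
  by apply: he; rewrite ker_liftE comp0m.
by rewrite -(ker_liftE eu) k0 comp0m.
Qed.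

Lemma exact_epi_cokernel X Y Z (f : Hom X Y) (g : Hom Y Z) :
  exact f g -> epi g -> is_cokernel f g.
Proof.
case=> e he hg; apply: is_cokernelI => // W h eh.
have hk : h ∘ kermap g = 0.
  by apply: he; rewrite -compmA ker_liftE comp0m.
have [V [q [eq hq]]] := epi_normal hg.
have [|u [eu _]] := hq W h; last by exists u.
by rewrite -(ker_liftE eq) compmA hk comp0m.
Qed.

Lemma exact_mono_kernel X Y Z (f : Hom X Y) (g : Hom Y Z) :
  exact f g -> mono f -> is_kernel g f.
Proof.
case=> e he hf; apply: is_kernelI => // W h eh.
have hl : mono (ker_lift e).
  by move=> V u v euv; apply: hf; rewrite -(ker_liftE e) -!compmA euv.
have [V [q [eq hq]]] := mono_normal hl.
have q0 : q = 0 by apply: he; rewrite eq comp0m.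
have [|t [et _]] := hq _ (idm _); first by rewrite q0 comp0m.
exists (t ∘ ker_lift eh).
by rewrite -(ker_liftE e) !compmA -(compmA (kermap g)) et compm1 ker_liftE.
Qed.

Lemma exact_coker X Y Z K (f : Hom X Y) (g : Hom Y Z) (c : Hom Y K) (m : Hom K Z) :
  is_cokernel f c -> mono m -> m ∘ c = g -> exact f g.
Proof.
move=> hc hm eg.
have e : g ∘ f = 0 by rewrite -eg -compmA (proj1 hc) compm0.
exists e; apply: epi0P => W u eu.
have hk : mono (kermap g ∘ kermap u).
  move=> V a b; rewrite -!compmA => /(@kermap_mono _ _ g).
  exact: (@kermap_mono _ _ u).
have [V [q [eq hq]]] := mono_normal hk.
have eqf : q ∘ f = 0.
  by rewrite -(ker_liftE e) -(ker_liftE eu) (compmA (kermap g)) compmA eq comp0m.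
have [q' [eq' _]] := proj2 hc _ _ eqf.
have ck0 : c ∘ kermap g = 0.
  by apply: hm; rewrite compmA eg kermap0 compm0.
have [|t [et _]] := hq _ (kermap g); first by rewrite -eq' -compmA ck0 compm0.
have e1 : kermap u ∘ t = idm _.
  by apply: (@kermap_mono _ _ g); rewrite compmA et compm1.
by rewrite -(compm1 u) -e1 compmA kermap0 comp0m.
Qed.

Lemma mono_is_ker X Y (f : Hom X Y) : mono f -> is_kernel (cokermap f) f.
Proof.
move=> hf; apply: is_kernelI => // [|W h eh]; first exact: cokermap0.
have [Z [g [eg hg]]] := mono_normal hf.
have [|u [eu _]] := hg W h; last by exists u.
by rewrite -(coker_descE eg) -compmA eh compm0.
Qed.

Lemma epi_is_coker X Y (f : Hom X Y) : epi f -> is_cokernel (kermap f) f.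
Proof.
move=> hf; apply: is_cokernelI => // [|W h eh]; first exact: kermap0.
have [Z [g [eg hg]]] := epi_normal hf.
have [|u [eu _]] := hg W h; last by exists u.
by rewrite -(ker_liftE eg) compmA eh comp0m.
Qed.

End Exactness.

(** * Functors and derived functors *)

Record functor (C D : preadditive) := Functor {
  fob :> C -> D;
  fmap : forall X Y : C, Hom X Y -> Hom (fob X) (fob Y);
  fmap1 : forall X : C, fmap (idm X) = idm (fob X);
  fmapM : forall (X Y Z : C) (g : Hom Y Z) (f : Hom X Y),
    fmap (g ∘ f) = fmap g ∘ fmap f;
  fmapD : forall (X Y : C) (f g : Hom X Y), fmap (f + g) = fmap f + fmap g
}.

Arguments fmap {C D} _ {X Y} _.

Lemma fmap0 (C D : preadditive) (F : functor C D) (X Y : C) :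
  fmap F (0 : Hom X Y) = 0.
Proof. by apply: (addrI (fmap F 0)); rewrite -fmapD !addr0. Qed.

Lemma fmap_comp0 (C D : preadditive) (F : functor C D) (X Y Z : C)
  (f : Hom X Y) (g : Hom Y Z) : g ∘ f = 0 -> fmap F g ∘ fmap F f = 0.
Proof. by move=> e; rewrite -fmapM e fmap0. Qed.

Definition right_exact (C D : abelian) (F : functor C D) :=
  forall (X Y Z : C) (f : Hom X Y) (g : Hom Y Z),
    exact f g -> exact g (0 : Hom Z zob) ->
    exact (fmap F f) (fmap F g) /\ exact (fmap F g) (0 : Hom (F Z) zob).

Definition left_exact (C D : abelian) (F : functor C D) :=
  forall (X Y Z : C) (f : Hom X Y) (g : Hom Y Z),
    exact (0 : Hom zob X) f -> exact f g ->
    exact (0 : Hom zob (F X)) (fmap F f) /\ exact (fmap F f) (fmap F g).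

Record rightExactFunctor (C D : abelian) := RightExactFunctor {
  rfun :> functor C D;
  rfunP : right_exact rfun
}.

Record leftExactFunctor (C D : abelian) := LeftExactFunctor {
  lfun :> functor C D;
  lfunP : left_exact lfun
}.

Section FunctorFacts.
Variables C D : abelian.

Lemma rfun_coker (F : rightExactFunctor C D) (X Y Z : C)
  (f : Hom X Y) (c : Hom Y Z) :
  is_cokernel f c -> is_cokernel (fmap F f) (fmap F c).
Proof.
move=> hc; have hce := cokernel_epi hc.
have [|e1 e2] := rfunP F (f := f) (g := c) _ (epi_exact0 hce).
  by apply: (exact_coker hc (m := idm Z)) => [W u v|]; rewrite !comp1m.
exact: exact_epi_cokernel e1 (exact0_epi e2).
Qed.

Lemma rfun_epi (F : rightExactFunctor C D) (X Y : C) (f : Hom X Y) :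
  epi f -> epi (fmap F f).
Proof. by move=> /epi_is_coker/(rfun_coker F)/cokernel_epi. Qed.

Lemma lfun_ker (F : leftExactFunctor C D) (X Y Z : C)
  (f : Hom X Y) (k : Hom Z X) :
  is_kernel f k -> is_kernel (fmap F f) (fmap F k).
Proof.
move=> hk; have hkm := kernel_mono hk.
have [|e1 e2] := lfunP F (f := k) (g := f) (mono_exact0 hkm).
  by apply: (exact_ker hk (p := idm Z)) => [W u v|]; rewrite !compm1.
exact: exact_mono_kernel e2 (exact0_mono e1).
Qed.

Lemma lfun_mono (F : leftExactFunctor C D) (X Y : C) (f : Hom X Y) :
  mono f -> mono (fmap F f).
Proof. by move=> /mono_is_ker/(lfun_ker F)/kernel_mono. Qed.

End FunctorFacts.

(* ... -> P 2 -> P 1 -> P 0 -> Y -> 0 *)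
Record proj_resolution (C : abelian) (Y : C) := ProjResolution {
  prob :> nat -> C;
  prd : forall j, Hom (prob j.+1) (prob j);
  praug : Hom (prob 0) Y;
  pr_proj : forall j, projective (prob j);
  pr_exact : forall j, exact (prd j.+1) (prd j);
  pr_exact0 : exact (prd 0) praug;
  pr_exact_aug : exact praug (0 : Hom Y zob)
}.

(* 0 -> Y -> I 0 -> I 1 -> I 2 -> ... *)
Record inj_resolution (C : abelian) (Y : C) := InjResolution {
  irob :> nat -> C;
  ird : forall j, Hom (irob j) (irob j.+1);
  iraug : Hom Y (irob 0);
  ir_inj : forall j, injective_ob (irob j);
  ir_exact : forall j, exact (ird j) (ird j.+1);
  ir_exact0 : exact iraug (ird 0);
  ir_exact_aug : exact (0 : Hom zob Y) iraug
}.

Section Resolutions.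
Variable C : abelian.

Lemma proj_resolution_exists (hC : enough_projectives C) (Y : C) :
  inhabited (proj_resolution Y).
Proof.
pose P X := projT1 (cid (hC X)).
pose p X := projT1 (cid (projT2 (cid (hC X)))) : Hom (P X) X.
have hp X : projective (P X) /\ epi (p X) := projT2 (cid (projT2 (cid (hC X)))).
pose S := fix S j := if j is i.+1 then ker (p (S i)) else Y.
constructor; apply: (@ProjResolution C Y (fun j => P (S j))
  (fun j => kermap (p (S j)) ∘ p (S j.+1)) (p Y)) => [j|j||].
- by case: (hp (S j)).
- apply: (@exact_ker _ _ _ _ _ _ _ (kermap (p (S j.+1))) (p (S j.+2))) => //.
  + apply: is_kernelI; first by rewrite -compmA kermap0 compm0.
      exact: kermap_mono.
    move=> W h; rewrite -compmA -(compm0 W (kermap (p (S j)))).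
    by move/(@kermap_mono _ _ _ _)=> e; exists (ker_lift e); rewrite ker_liftE.
  + by case: (hp (S j.+2)).
- apply: (@exact_ker _ _ _ _ _ _ _ (kermap (p Y)) (p (S 1%N))) => //.
    exact: kermapP.
  by case: (hp (S 1%N)).
- by apply: epi_exact0; case: (hp Y).
Qed.

Lemma inj_resolution_exists (hC : enough_injectives C) (Y : C) :
  inhabited (inj_resolution Y).
Proof.
pose I X := projT1 (cid (hC X)).
pose i X := projT1 (cid (projT2 (cid (hC X)))) : Hom X (I X).
have hi X : injective_ob (I X) /\ mono (i X) := projT2 (cid (projT2 (cid (hC X)))).
pose S := fix S j := if j is k.+1 then coker (i (S k)) else Y.
constructor; apply: (@InjResolution C Y (fun j => I (S j))
  (fun j => i (S j.+1) ∘ cokermap (i (S j))) (i Y)) => [j|j||].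
- by case: (hi (S j)).
- apply: (@exact_coker _ _ _ _ _ _ _ (cokermap (i (S j.+1))) (i (S j.+2))) => //.
  + apply: is_cokernelI; first by rewrite compmA cokermap0 comp0m.
      exact: cokermap_epi.
    move=> W h; rewrite compmA -(comp0m W (cokermap (i (S j)))).
    by move/(@cokermap_epi _ _ _ _)=> e; exists (coker_desc e); rewrite coker_descE.
  + by case: (hi (S j.+2)).
- apply: (@exact_coker _ _ _ _ _ _ _ (cokermap (i Y)) (i (S 1%N))) => //.
    exact: cokermapP.
  by case: (hi (S 1%N)).
- by apply: mono_exact0; case: (hi Y).
Qed.

Lemma prd0 (Y : C) (P : proj_resolution Y) j : prd P j ∘ prd P j.+1 = 0.
Proof. by case: (pr_exact P j). Qed.

Lemma ird0 (Y : C) (I : inj_resolution Y) j : ird I j.+1 ∘ ird I j = 0.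
Proof. by case: (ir_exact I j). Qed.

Definition the_proj_resolution (hC : enough_projectives C) (Y : C) :
  proj_resolution Y := inhabited_witness (proj_resolution_exists hC Y).

Definition the_inj_resolution (hC : enough_injectives C) (Y : C) :
  inj_resolution Y := inhabited_witness (inj_resolution_exists hC Y).

End Resolutions.

Section Derived.
Variables C D : abelian.

Definition left_derived (hC : enough_projectives C) (F : functor C D)
    (j : nat) (Y : C) : D :=
  let P := the_proj_resolution hC Y in
  match j with
  | 0 => coker (fmap F (prd P 0))
  | i.+1 => homology (fmap_comp0 F (prd0 P i))
  end.

Definition right_derived (hC : enough_injectives C) (F : functor C D)
    (j : nat) (Y : C) : D :=
  let I := the_inj_resolution hC Y in
  match j with
  | 0 => ker (fmap F (ird I 0))
  | i.+1 => homology (fmap_comp0 F (ird0 I i))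
  end.

End Derived.

(** * Finite exact sequences and Yoneda Ext *)

Section Sequences.
Variable C : abelian.

(* Strings X -> Y_1 -> ... -> Y_n -> Z of composable morphisms; [n] counts the
   intermediate objects. *)
Fixpoint chain (n : nat) (X Z : C) : Type :=
  match n with
  | 0 => Hom X Z
  | m.+1 => {Y : C & (Hom X Y * chain m Y Z)%type}
  end.

(* Exactness of W -f-> X -> Y_1 -> ... -> Y_n -> Z -> 0 at X, the Y_i and Z. *)
Fixpoint exact_from (n : nat) :
    forall W X Z : C, Hom W X -> chain n X Z -> Prop :=
  match n with
  | 0 => fun W X Z f c => exact f c /\ exact (c : Hom X Z) (0 : Hom Z zob)
  | m.+1 => fun W X Z f c =>
      exact f (projT2 c).1 /\ exact_from (projT2 c).1 (projT2 c).2
  end.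

(* 0 -> X -> Y_1 -> ... -> Y_n -> Z -> 0 is exact *)
Definition exact_chain n (X Z : C) (c : chain n X Z) :=
  exact_from (0 : Hom zob X) c.

Fixpoint chain_inner (P : C -> Prop) (n : nat) :
    forall X Z : C, chain n X Z -> Prop :=
  match n with
  | 0 => fun X Z c => True
  | m.+1 => fun X Z c => P (projT1 c) /\ chain_inner P (projT2 c).2
  end.

(* [u] extends to a morphism of strings which is the identity of Z at the last
   object. *)
Fixpoint chain_morph (n : nat) :
    forall X X' Z : C, Hom X X' -> chain n X Z -> chain n X' Z -> Prop :=
  match n with
  | 0 => fun X X' Z u c c' => c = (c' : Hom X' Z) ∘ u
  | m.+1 => fun X X' Z u c c' =>
      exists v : Hom (projT1 c) (projT1 c'),
        v ∘ (projT2 c).1 = (projT2 c').1 ∘ u /\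
        chain_morph v (projT2 c).2 (projT2 c').2
  end.

(* n-fold extensions 0 -> Y -> E_n -> ... -> E_1 -> X -> 0 *)
Definition extension n (X Y : C) := {c : chain n Y X | exact_chain c}.

Definition extension_morph n (X Y : C) (e e' : extension n X Y) :=
  chain_morph (idm Y) (proj1_sig e) (proj1_sig e').

Definition yoneda_equiv n (X Y : C) :=
  clos_refl_sym_trans (extension n X Y) (@extension_morph n X Y).

(* Ext^n(X, Y), n >= 1, is the set of n-fold extensions modulo [yoneda_equiv],
   a group under Baer sum; it always contains the class 0, so it vanishes iff
   it has at most one element.  This applies to abelian categories which lack
   projectives or injectives, as the comma categories below may do. *)
Definition ext_zero n (X Y : C) :=
  forall e e' : extension n X Y, yoneda_equiv e e'.

Definition wedge (P : C -> Prop) (m : nat) (X : C) :=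
  exists k, (k <= m)%N /\
  exists (Ck : C) (c : chain k Ck X), [/\ exact_chain c, P Ck & chain_inner P c].

Definition vee (P : C -> Prop) (m : nat) (X : C) :=
  exists k, (k <= m)%N /\
  exists (Ck : C) (c : chain k X Ck), [/\ exact_chain c, P Ck & chain_inner P c].

(** * n-cotorsion pairs *)

(* The standing convention on classes of objects. *)
Definition object_class (P : C -> Prop) :=
  P zob /\ forall X Y : C, isomorphic X Y -> P X -> P Y.

Definition summand_closed (P : C -> Prop) :=
  forall X Y Z : C, P Z -> isomorphic Z (bip X Y) -> P X.

Definition extension_closed (P : C -> Prop) :=
  forall (X Y Z : C) (f : Hom X Y) (g : Hom Y Z),
    short_exact f g -> P X -> P Z -> P Y.

Definition left_cotorsion_pair (n : nat) (P Q : C -> Prop) :=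
  [/\ summand_closed P,
      forall i X Y, (1 <= i <= n)%N -> P X -> Q Y -> ext_zero i X Y
    & forall A : C, exists (K X : C) (f : Hom K X) (g : Hom X A),
        [/\ short_exact f g, P X & wedge Q n.-1 K]].

Definition right_cotorsion_pair (n : nat) (P Q : C -> Prop) :=
  [/\ summand_closed Q,
      forall i X Y, (1 <= i <= n)%N -> P X -> Q Y -> ext_zero i X Y
    & forall A : C, exists (Y K : C) (f : Hom A Y) (g : Hom Y K),
        [/\ short_exact f g, Q Y & vee P n.-1 K]].

Definition hereditary (n : nat) (P Q : C -> Prop) :=
  forall X Y, P X -> Q Y -> ext_zero n.+1 X Y.

Definition hereditary_left_cotorsion_pair n (P Q : C -> Prop) :=
  left_cotorsion_pair n P Q /\ hereditary n P Q.

Definition hereditary_right_cotorsion_pair n (P Q : C -> Prop) :=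
  right_cotorsion_pair n P Q /\ hereditary n P Q.

End Sequences.

(** * The comma category (T ↓ A) *)

Record Tob (A B : preadditive) (T : functor B A) := TOb {
  tA : A; tB : B; tphi : Hom (T tB) tA }.

Record Tmor (A B : preadditive) (T : functor B A) (X Y : Tob T) := TMor {
  ta : Hom (tA X) (tA Y);
  tb : Hom (tB X) (tB Y);
  tcomm : tphi Y ∘ fmap T tb = ta ∘ tphi X }.

Section TComma.
Variables (A B : preadditive) (T : functor B A).
Implicit Types X Y Z : Tob T.

Lemma Tmor_eq X Y (f g : Tmor X Y) : ta f = ta g -> tb f = tb g -> f = g.
Proof.
case: f g => [a b c] [a' b' c'] /= ea eb.
by subst a' b'; rewrite (Prop_irrelevance c c').
Qed.

HB.instance Definition _ X Y := gen_eqMixin (Tmor X Y).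
HB.instance Definition _ X Y := gen_choiceMixin (Tmor X Y).

Fact Tzero_comm X Y : tphi Y ∘ fmap T (0 : Hom (tB X) (tB Y)) = 0 ∘ tphi X.
Proof. by rewrite fmap0 compm0 comp0m. Qed.

Fact Tadd_comm X Y (f g : Tmor X Y) :
  tphi Y ∘ fmap T (tb f + tb g) = (ta f + ta g) ∘ tphi X.
Proof. by rewrite fmapD compDr compDl !tcomm. Qed.

Fact Topp_comm X Y (f : Tmor X Y) :
  tphi Y ∘ fmap T (- tb f) = (- ta f) ∘ tphi X.
Proof.
apply: (addrI (ta f ∘ tphi X)).
by rewrite -{1}tcomm -compDr -compDl -fmapD !subrr fmap0 compm0 comp0m.
Qed.

Definition Tzero X Y := TMor (Tzero_comm X Y).
Definition Tadd X Y (f g : Tmor X Y) := TMor (Tadd_comm f g).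
Definition Topp X Y (f : Tmor X Y) := TMor (Topp_comm f).

Fact TaddA X Y : associative (@Tadd X Y).
Proof. by move=> f g h; apply: Tmor_eq; rewrite /= addrA. Qed.
Fact TaddC X Y : commutative (@Tadd X Y).
Proof. by move=> f g; apply: Tmor_eq; rewrite /= addrC. Qed.
Fact Tadd0 X Y : left_id (Tzero X Y) (@Tadd X Y).
Proof. by move=> f; apply: Tmor_eq; rewrite /= add0r. Qed.
Fact TaddN X Y : left_inverse (Tzero X Y) (@Topp X Y) (@Tadd X Y).
Proof. by move=> f; apply: Tmor_eq; rewrite /= addNr. Qed.

HB.instance Definition _ X Y := GRing.isZmodule.Build (Tmor X Y)
  (@TaddA X Y) (@TaddC X Y) (@Tadd0 X Y) (@TaddN X Y).

Fact Tid_comm X : tphi X ∘ fmap T (idm (tB X)) = idm (tA X) ∘ tphi X.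
Proof. by rewrite fmap1 compm1 comp1m. Qed.

Fact Tcomp_comm X Y Z (g : Tmor Y Z) (f : Tmor X Y) :
  tphi Z ∘ fmap T (tb g ∘ tb f) = (ta g ∘ ta f) ∘ tphi X.
Proof. by rewrite fmapM compmA tcomm -compmA tcomm compmA. Qed.

Definition Tid X : Tmor X X := TMor (Tid_comm X).
Definition Tcomp X Y Z (g : Tmor Y Z) (f : Tmor X Y) : Tmor X Z :=
  TMor (Tcomp_comm g f).

Definition Tpreadditive : preadditive.
Proof.
refine (@Preadditive (Tob T) (fun X Y => Tmor X Y) Tid Tcomp _ _ _ _ _).
- by move=> X Y f; apply: Tmor_eq; rewrite /= comp1m.
- by move=> X Y f; apply: Tmor_eq; rewrite /= compm1.
- by move=> W X Y Z h g f; apply: Tmor_eq; rewrite /= compmA.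
- by move=> X Y Z g g' f; apply: Tmor_eq; rewrite /= compDl.
- by move=> X Y Z g f f'; apply: Tmor_eq; rewrite /= compDr.
Defined.

End TComma.

Section TCommaAbelian.
Variables (A B : abelian) (T : rightExactFunctor B A).
Let P := Tpreadditive T.
Implicit Types X Y Z : P.

Let Teq X Y (f g : Hom X Y) : ta f = ta g -> tb f = tb g -> f = g.
Proof. exact: Tmor_eq. Qed.

Definition Tzob : P := TOb (0 : Hom (T zob) zob).

Lemma TzobP : is_zero Tzob.
Proof.
move=> Y; split=> f g; apply: Teq.
- exact: (proj1 (zobP _)).
- exact: (proj1 (zobP _)).
- exact: (proj2 (zobP _)).
- exact: (proj2 (zobP _)).
Qed.

Definition Tbip X Y : P :=
  @TOb A B T (bip (tA X) (tA Y)) (bip (tB X) (tB Y))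
    (bin1 _ _ ∘ tphi X ∘ fmap T (bpr1 _ _) + bin2 _ _ ∘ tphi Y ∘ fmap T (bpr2 _ _)).

Fact Tbin1_comm X Y :
  tphi (Tbip X Y) ∘ fmap T (bin1 (tB X) (tB Y)) = bin1 _ _ ∘ tphi X.
Proof.
case: (bipP (tB X) (tB Y)) => e1 e2 e3 e4 _.
by rewrite compDl -!compmA -!fmapM e1 e4 fmap1 fmap0 compm1 !compm0 addr0.
Qed.
Fact Tbin2_comm X Y :
  tphi (Tbip X Y) ∘ fmap T (bin2 (tB X) (tB Y)) = bin2 _ _ ∘ tphi Y.
Proof.
case: (bipP (tB X) (tB Y)) => e1 e2 e3 e4 _.
by rewrite compDl -!compmA -!fmapM e2 e3 fmap1 fmap0 compm1 !compm0 add0r.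
Qed.
Fact Tbpr1_comm X Y :
  tphi X ∘ fmap T (bpr1 (tB X) (tB Y)) = bpr1 _ _ ∘ tphi (Tbip X Y).
Proof.
case: (bipP (tA X) (tA Y)) => e1 e2 e3 e4 _.
by rewrite compDr !compmA e1 e3 comp1m !comp0m addr0.
Qed.
Fact Tbpr2_comm X Y :
  tphi Y ∘ fmap T (bpr2 (tB X) (tB Y)) = bpr2 _ _ ∘ tphi (Tbip X Y).
Proof.
case: (bipP (tA X) (tA Y)) => e1 e2 e3 e4 _.
by rewrite compDr !compmA e2 e4 comp1m !comp0m add0r.
Qed.

Definition Tbin1 X Y : Hom X (Tbip X Y) :=
  @TMor A B T X (Tbip X Y) _ _ (Tbin1_comm X Y).
Definition Tbin2 X Y : Hom Y (Tbip X Y) :=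
  @TMor A B T Y (Tbip X Y) _ _ (Tbin2_comm X Y).
Definition Tbpr1 X Y : Hom (Tbip X Y) X :=
  @TMor A B T (Tbip X Y) X _ _ (Tbpr1_comm X Y).
Definition Tbpr2 X Y : Hom (Tbip X Y) Y :=
  @TMor A B T (Tbip X Y) Y _ _ (Tbpr2_comm X Y).

Lemma TbipP X Y : is_biproduct (Tbin1 X Y) (Tbin2 X Y) (Tbpr1 X Y) (Tbpr2 X Y).
Proof.
case: (bipP (tA X) (tA Y)) => ? ? ? ? ?; case: (bipP (tB X) (tB Y)) => ? ? ? ? ?.
by split; apply: Teq.
Qed.

Fact Tker_comm0 X Y (f : Hom X Y) :
  ta f ∘ (tphi X ∘ fmap T (kermap (tb f))) = 0.
Proof. by rewrite compmA -tcomm -compmA -fmapM kermap0 fmap0 compm0. Qed.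

Definition Tker X Y (f : Hom X Y) : P :=
  @TOb A B T (ker (ta f)) (ker (tb f)) (ker_lift (Tker_comm0 f)).

Definition Tkermap X Y (f : Hom X Y) : Hom (Tker f) X :=
  @TMor A B T (Tker f) X (kermap (ta f)) (kermap (tb f))
    (esym (ker_liftE (Tker_comm0 f))).

Lemma Tkernel_of X Y (f : Hom X Y) K (k : Hom K X) :
  is_kernel (ta f) (ta k) -> is_kernel (tb f) (tb k) -> is_kernel f k.
Proof.
move=> [ea ha] [eb hb]; apply: is_kernelI; first exact: Teq.
- move=> W u v e; apply: Teq.
  + by apply: (kernel_mono (conj ea ha)); exact: (congr1 (@ta _ _ _ _ _) e).
  + by apply: (kernel_mono (conj eb hb)); exact: (congr1 (@tb _ _ _ _ _) e).
- move=> W h e.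
  have [u [eu _]] := ha _ _ (congr1 (@ta _ _ _ _ _) e).
  have [v [ev _]] := hb _ _ (congr1 (@tb _ _ _ _ _) e).
  have c : tphi K ∘ fmap T v = u ∘ tphi W.
    apply: (kernel_mono (conj ea ha)).
    by rewrite compmA -tcomm -compmA -fmapM ev compmA eu tcomm.
  by exists (TMor c); apply: Teq.
Qed.

Lemma TkermapP X Y (f : Hom X Y) : is_kernel f (Tkermap f).
Proof. by apply: Tkernel_of; exact: kermapP. Qed.

Fact Tcoker_comm0 X Y (f : Hom X Y) :
  (cokermap (ta f) ∘ tphi Y) ∘ fmap T (tb f) = 0.
Proof. by rewrite -compmA tcomm compmA cokermap0 comp0m. Qed.

Definition Tcoker_phi X Y (f : Hom X Y) :
    Hom (T (coker (tb f))) (coker (ta f)) :=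
  projT1 (cid (proj2 (rfun_coker T (cokermapP (tb f))) _ _ (Tcoker_comm0 f))).

Fact Tcoker_phiE X Y (f : Hom X Y) :
  Tcoker_phi f ∘ fmap T (cokermap (tb f)) = cokermap (ta f) ∘ tphi Y.
Proof. by rewrite /Tcoker_phi; case: cid => u []. Qed.

Definition Tcoker X Y (f : Hom X Y) : P :=
  @TOb A B T (coker (ta f)) (coker (tb f)) (Tcoker_phi f).

Definition Tcokermap X Y (f : Hom X Y) : Hom Y (Tcoker f) :=
  @TMor A B T Y (Tcoker f) (cokermap (ta f)) (cokermap (tb f)) (Tcoker_phiE f).

Lemma Tcokernel_of X Y (f : Hom X Y) K (k : Hom Y K) :
  is_cokernel (ta f) (ta k) -> is_cokernel (tb f) (tb k) -> is_cokernel f k.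
Proof.
move=> [ea ha] [eb hb]; apply: is_cokernelI; first exact: Teq.
- move=> W u v e; apply: Teq.
  + by apply: (cokernel_epi (conj ea ha)); exact: (congr1 (@ta _ _ _ _ _) e).
  + by apply: (cokernel_epi (conj eb hb)); exact: (congr1 (@tb _ _ _ _ _) e).
- move=> W h e.
  have [u [eu _]] := ha _ _ (congr1 (@ta _ _ _ _ _) e).
  have [v [ev _]] := hb _ _ (congr1 (@tb _ _ _ _ _) e).
  have c : tphi W ∘ fmap T v = u ∘ tphi K.
    apply: (rfun_epi (cokernel_epi (conj eb hb))).
    by rewrite -compmA -fmapM ev tcomm -compmA tcomm compmA eu.
  by exists (TMor c); apply: Teq.
Qed.

Lemma TcokermapP X Y (f : Hom X Y) : is_cokernel f (Tcokermap f).
Proof. by apply: Tcokernel_of; exact: cokermapP. Qed.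

Lemma Tmono X Y (f : Hom X Y) : mono f -> mono (ta f) /\ mono (tb f).
Proof.
move=> hf; have k0 : Tkermap f = 0.
  by apply: hf; rewrite compm0; case: (TkermapP f).
have ka : kermap (ta f) = 0 := congr1 (@ta _ _ _ _ _) k0.
have kb : kermap (tb f) = 0 := congr1 (@tb _ _ _ _ _) k0.
by split; apply: mono0P => W u eu; rewrite -(ker_liftE eu) ?ka ?kb comp0m.
Qed.

Lemma Tepi X Y (f : Hom X Y) : epi f -> epi (ta f) /\ epi (tb f).
Proof.
move=> hf; have k0 : Tcokermap f = 0.
  by apply: hf; rewrite comp0m; case: (TcokermapP f).
have ka : cokermap (ta f) = 0 := congr1 (@ta _ _ _ _ _) k0.
have kb : cokermap (tb f) = 0 := congr1 (@tb _ _ _ _ _) k0.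
by split; apply: epi0P => W u eu; rewrite -(coker_descE eu) ?ka ?kb compm0.
Qed.

Lemma Tmono_normal X Y (f : Hom X Y) : mono f ->
  exists (Z : P) (g : Hom Y Z), is_kernel g f.
Proof.
case/Tmono=> ha hb; exists (Tcoker f), (Tcokermap f).
by apply: Tkernel_of; exact: mono_is_ker.
Qed.

Lemma Tepi_normal X Y (f : Hom X Y) : epi f ->
  exists (Z : P) (g : Hom Z X), is_cokernel g f.
Proof.
case/Tepi=> ha hb; exists (Tker f), (Tkermap f).
by apply: Tcokernel_of; exact: epi_is_coker.
Qed.

Definition Tcomma : abelian :=
  Abelian TzobP TbipP TkermapP TcokermapP Tmono_normal Tepi_normal.

Definition Tpair_class (PA : A -> Prop) (PB : B -> Prop) (X : Tcomma) :=
  PA (tA X) /\ PB (tB X).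

Definition Bclass (PA : A -> Prop) (PB : B -> Prop) (X : Tcomma) :=
  [/\ PB (tB X), mono (tphi X) & PA (coker (tphi X))].

End TCommaAbelian.

(** * The comma category (B ↓ G) *)

Record Gob (A B : preadditive) (G : functor A B) := GOb {
  gA : A; gB : B; gphi : Hom gB (G gA) }.

Record Gmor (A B : preadditive) (G : functor A B) (X Y : Gob G) := GMor {
  ga : Hom (gA X) (gA Y);
  gb : Hom (gB X) (gB Y);
  gcomm : gphi Y ∘ gb = fmap G ga ∘ gphi X }.

Section GComma.
Variables (A B : preadditive) (G : functor A B).
Implicit Types X Y Z : Gob G.

Lemma Gmor_eq X Y (f g : Gmor X Y) : ga f = ga g -> gb f = gb g -> f = g.
Proof.
case: f g => [a b c] [a' b' c'] /= ea eb.
by subst a' b'; rewrite (Prop_irrelevance c c').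
Qed.

HB.instance Definition _ X Y := gen_eqMixin (Gmor X Y).
HB.instance Definition _ X Y := gen_choiceMixin (Gmor X Y).

Fact Gzero_comm X Y : gphi Y ∘ 0 = fmap G (0 : Hom (gA X) (gA Y)) ∘ gphi X.
Proof. by rewrite fmap0 compm0 comp0m. Qed.

Fact Gadd_comm X Y (f g : Gmor X Y) :
  gphi Y ∘ (gb f + gb g) = fmap G (ga f + ga g) ∘ gphi X.
Proof. by rewrite fmapD compDr compDl !gcomm. Qed.

Fact Gopp_comm X Y (f : Gmor X Y) :
  gphi Y ∘ (- gb f) = fmap G (- ga f) ∘ gphi X.
Proof.
apply: (addrI (gphi Y ∘ gb f)).
by rewrite {2}gcomm -compDr -compDl -fmapD !subrr fmap0 compm0 comp0m.
Qed.

Definition Gzero X Y := GMor (Gzero_comm X Y).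
Definition Gadd X Y (f g : Gmor X Y) := GMor (Gadd_comm f g).
Definition Gopp X Y (f : Gmor X Y) := GMor (Gopp_comm f).

Fact GaddA X Y : associative (@Gadd X Y).
Proof. by move=> f g h; apply: Gmor_eq; rewrite /= addrA. Qed.
Fact GaddC X Y : commutative (@Gadd X Y).
Proof. by move=> f g; apply: Gmor_eq; rewrite /= addrC. Qed.
Fact Gadd0 X Y : left_id (Gzero X Y) (@Gadd X Y).
Proof. by move=> f; apply: Gmor_eq; rewrite /= add0r. Qed.
Fact GaddN X Y : left_inverse (Gzero X Y) (@Gopp X Y) (@Gadd X Y).
Proof. by move=> f; apply: Gmor_eq; rewrite /= addNr. Qed.

HB.instance Definition _ X Y := GRing.isZmodule.Build (Gmor X Y)
  (@GaddA X Y) (@GaddC X Y) (@Gadd0 X Y) (@GaddN X Y).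

Fact Gid_comm X : gphi X ∘ idm (gB X) = fmap G (idm (gA X)) ∘ gphi X.
Proof. by rewrite fmap1 compm1 comp1m. Qed.

Fact Gcomp_comm X Y Z (g : Gmor Y Z) (f : Gmor X Y) :
  gphi Z ∘ (gb g ∘ gb f) = fmap G (ga g ∘ ga f) ∘ gphi X.
Proof. by rewrite fmapM compmA gcomm -compmA gcomm compmA. Qed.

Definition Gid X : Gmor X X := GMor (Gid_comm X).
Definition Gcomp X Y Z (g : Gmor Y Z) (f : Gmor X Y) : Gmor X Z :=
  GMor (Gcomp_comm g f).

Definition Gpreadditive : preadditive.
Proof.
refine (@Preadditive (Gob G) (fun X Y => Gmor X Y) Gid Gcomp _ _ _ _ _).
- by move=> X Y f; apply: Gmor_eq; rewrite /= comp1m.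
- by move=> X Y f; apply: Gmor_eq; rewrite /= compm1.
- by move=> W X Y Z h g f; apply: Gmor_eq; rewrite /= compmA.
- by move=> X Y Z g g' f; apply: Gmor_eq; rewrite /= compDl.
- by move=> X Y Z g f f'; apply: Gmor_eq; rewrite /= compDr.
Defined.

End GComma.

Section GCommaAbelian.
Variables (A B : abelian) (G : leftExactFunctor A B).
Let P := Gpreadditive G.
Implicit Types X Y Z : P.

Let Geq X Y (f g : Hom X Y) : ga f = ga g -> gb f = gb g -> f = g.
Proof. exact: Gmor_eq. Qed.

Definition Gzob : P := GOb (0 : Hom zob (G zob)).

Lemma GzobP : is_zero Gzob.
Proof.
move=> Y; split=> f g; apply: Geq.
- exact: (proj1 (zobP _)).
- exact: (proj1 (zobP _)).
- exact: (proj2 (zobP _)).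
- exact: (proj2 (zobP _)).
Qed.

Definition Gbip X Y : P :=
  @GOb A B G (bip (gA X) (gA Y)) (bip (gB X) (gB Y))
    (fmap G (bin1 _ _) ∘ gphi X ∘ bpr1 _ _ + fmap G (bin2 _ _) ∘ gphi Y ∘ bpr2 _ _).

Fact Gbin1_comm X Y :
  gphi (Gbip X Y) ∘ bin1 (gB X) (gB Y) = fmap G (bin1 _ _) ∘ gphi X.
Proof.
case: (bipP (gB X) (gB Y)) => e1 e2 e3 e4 _.
by rewrite compDl -!compmA e1 e4 compm1 !compm0 addr0.
Qed.
Fact Gbin2_comm X Y :
  gphi (Gbip X Y) ∘ bin2 (gB X) (gB Y) = fmap G (bin2 _ _) ∘ gphi Y.
Proof.
case: (bipP (gB X) (gB Y)) => e1 e2 e3 e4 _.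
by rewrite compDl -!compmA e2 e3 compm1 !compm0 add0r.
Qed.
Fact Gbpr1_comm X Y :
  gphi X ∘ bpr1 (gB X) (gB Y) = fmap G (bpr1 _ _) ∘ gphi (Gbip X Y).
Proof.
case: (bipP (gA X) (gA Y)) => e1 e2 e3 e4 _.
by rewrite compDr !compmA -!fmapM e1 e3 fmap1 fmap0 comp1m !comp0m addr0.
Qed.
Fact Gbpr2_comm X Y :
  gphi Y ∘ bpr2 (gB X) (gB Y) = fmap G (bpr2 _ _) ∘ gphi (Gbip X Y).
Proof.
case: (bipP (gA X) (gA Y)) => e1 e2 e3 e4 _.
by rewrite compDr !compmA -!fmapM e2 e4 fmap1 fmap0 comp1m !comp0m add0r.
Qed.

Definition Gbin1 X Y : Hom X (Gbip X Y) :=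
  @GMor A B G X (Gbip X Y) _ _ (Gbin1_comm X Y).
Definition Gbin2 X Y : Hom Y (Gbip X Y) :=
  @GMor A B G Y (Gbip X Y) _ _ (Gbin2_comm X Y).
Definition Gbpr1 X Y : Hom (Gbip X Y) X :=
  @GMor A B G (Gbip X Y) X _ _ (Gbpr1_comm X Y).
Definition Gbpr2 X Y : Hom (Gbip X Y) Y :=
  @GMor A B G (Gbip X Y) Y _ _ (Gbpr2_comm X Y).

Lemma GbipP X Y : is_biproduct (Gbin1 X Y) (Gbin2 X Y) (Gbpr1 X Y) (Gbpr2 X Y).
Proof.
case: (bipP (gA X) (gA Y)) => ? ? ? ? ?; case: (bipP (gB X) (gB Y)) => ? ? ? ? ?.
by split; apply: Geq.
Qed.

Fact Gker_comm0 X Y (f : Hom X Y) :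
  fmap G (ga f) ∘ (gphi X ∘ kermap (gb f)) = 0.
Proof. by rewrite compmA -gcomm -compmA kermap0 compm0. Qed.

Definition Gker_phi X Y (f : Hom X Y) : Hom (ker (gb f)) (G (ker (ga f))) :=
  projT1 (cid (proj2 (lfun_ker G (kermapP (ga f))) _ _ (Gker_comm0 f))).

Fact Gker_phiE X Y (f : Hom X Y) :
  gphi X ∘ kermap (gb f) = fmap G (kermap (ga f)) ∘ Gker_phi f.
Proof. by rewrite /Gker_phi; case: cid => u []. Qed.

Definition Gker X Y (f : Hom X Y) : P :=
  @GOb A B G (ker (ga f)) (ker (gb f)) (Gker_phi f).

Definition Gkermap X Y (f : Hom X Y) : Hom (Gker f) X :=
  @GMor A B G (Gker f) X (kermap (ga f)) (kermap (gb f)) (Gker_phiE f).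

Lemma Gkernel_of X Y (f : Hom X Y) K (k : Hom K X) :
  is_kernel (ga f) (ga k) -> is_kernel (gb f) (gb k) -> is_kernel f k.
Proof.
move=> [ea ha] [eb hb]; apply: is_kernelI; first exact: Geq.
- move=> W u v e; apply: Geq.
  + by apply: (kernel_mono (conj ea ha)); exact: (congr1 (@ga _ _ _ _ _) e).
  + by apply: (kernel_mono (conj eb hb)); exact: (congr1 (@gb _ _ _ _ _) e).
- move=> W h e.
  have [u [eu _]] := ha _ _ (congr1 (@ga _ _ _ _ _) e).
  have [v [ev _]] := hb _ _ (congr1 (@gb _ _ _ _ _) e).
  have c : gphi K ∘ v = fmap G u ∘ gphi W.
    apply: (lfun_mono (kernel_mono (conj ea ha))).
    by rewrite compmA -gcomm -compmA ev compmA -fmapM eu gcomm.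
  by exists (GMor c); apply: Geq.
Qed.

Lemma GkermapP X Y (f : Hom X Y) : is_kernel f (Gkermap f).
Proof. by apply: Gkernel_of; exact: kermapP. Qed.

Fact Gcoker_comm0 X Y (f : Hom X Y) :
  (fmap G (cokermap (ga f)) ∘ gphi Y) ∘ gb f = 0.
Proof. by rewrite -compmA gcomm compmA -fmapM cokermap0 fmap0 comp0m. Qed.

Definition Gcoker X Y (f : Hom X Y) : P :=
  @GOb A B G (coker (ga f)) (coker (gb f)) (coker_desc (Gcoker_comm0 f)).

Definition Gcokermap X Y (f : Hom X Y) : Hom Y (Gcoker f) :=
  @GMor A B G Y (Gcoker f) (cokermap (ga f)) (cokermap (gb f))
    (coker_descE (Gcoker_comm0 f)).

Lemma Gcokernel_of X Y (f : Hom X Y) K (k : Hom Y K) :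
  is_cokernel (ga f) (ga k) -> is_cokernel (gb f) (gb k) -> is_cokernel f k.
Proof.
move=> [ea ha] [eb hb]; apply: is_cokernelI; first exact: Geq.
- move=> W u v e; apply: Geq.
  + by apply: (cokernel_epi (conj ea ha)); exact: (congr1 (@ga _ _ _ _ _) e).
  + by apply: (cokernel_epi (conj eb hb)); exact: (congr1 (@gb _ _ _ _ _) e).
- move=> W h e.
  have [u [eu _]] := ha _ _ (congr1 (@ga _ _ _ _ _) e).
  have [v [ev _]] := hb _ _ (congr1 (@gb _ _ _ _ _) e).
  have c : gphi W ∘ v = fmap G u ∘ gphi K.
    apply: (cokernel_epi (conj eb hb)).
    by rewrite -compmA ev gcomm -compmA gcomm compmA -fmapM eu.
  by exists (GMor c); apply: Geq.
Qed.

Lemma GcokermapP X Y (f : Hom X Y) : is_cokernel f (Gcokermap f).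
Proof. by apply: Gcokernel_of; exact: cokermapP. Qed.

Lemma Gmono X Y (f : Hom X Y) : mono f -> mono (ga f) /\ mono (gb f).
Proof.
move=> hf; have k0 : Gkermap f = 0.
  by apply: hf; rewrite compm0; case: (GkermapP f).
have ka : kermap (ga f) = 0 := congr1 (@ga _ _ _ _ _) k0.
have kb : kermap (gb f) = 0 := congr1 (@gb _ _ _ _ _) k0.
by split; apply: mono0P => W u eu; rewrite -(ker_liftE eu) ?ka ?kb comp0m.
Qed.

Lemma Gepi X Y (f : Hom X Y) : epi f -> epi (ga f) /\ epi (gb f).
Proof.
move=> hf; have k0 : Gcokermap f = 0.
  by apply: hf; rewrite comp0m; case: (GcokermapP f).
have ka : cokermap (ga f) = 0 := congr1 (@ga _ _ _ _ _) k0.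
have kb : cokermap (gb f) = 0 := congr1 (@gb _ _ _ _ _) k0.
by split; apply: epi0P => W u eu; rewrite -(coker_descE eu) ?ka ?kb compm0.
Qed.

Lemma Gmono_normal X Y (f : Hom X Y) : mono f ->
  exists (Z : P) (g : Hom Y Z), is_kernel g f.
Proof.
case/Gmono=> ha hb; exists (Gcoker f), (Gcokermap f).
by apply: Gkernel_of; exact: mono_is_ker.
Qed.

Lemma Gepi_normal X Y (f : Hom X Y) : epi f ->
  exists (Z : P) (g : Hom Z X), is_cokernel g f.
Proof.
case/Gepi=> ha hb; exists (Gker f), (Gkermap f).
by apply: Gcokernel_of; exact: epi_is_coker.
Qed.

Definition Gcomma : abelian :=
  Abelian GzobP GbipP GkermapP GcokermapP Gmono_normal Gepi_normal.

Definition Gpair_class (PA : A -> Prop) (PB : B -> Prop) (X : Gcomma) :=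
  PA (gA X) /\ PB (gB X).

Definition Dclass (PA : A -> Prop) (PB : B -> Prop) (X : Gcomma) :=
  [/\ PA (gA X), epi (gphi X) & PB (ker (gphi X))].

End GCommaAbelian.

(* Main.v *)
From mathcomp Require Import all_boot ssralg.
From mathcomp Require Import boolp.
From Stdlib Require Import Relation_Operators.
Require Import Defs.

Set Implicit Arguments.
Unset Strict Implicit.
Unset Printing Implicit Defensive.

Import GRing.Theory.
Local Open Scope ring_scope.

(** Why the theorem holds.

    In part (1) the comma category is compared with A and B through its two
    projections, which are exact.  Closure under direct summands is checked on
    the objects (X, 0) and (0, Y).  An approximation of (a, 0) projects to one
    of a, and projections carry finite resolutions to finite resolutions.

    Vanishing of Ext descends along an exact functor if every Yoneda extension
    downstairs is equivalent to the image of one upstairs (ext_zero_map).  So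
    Ext is never computed; extensions are lifted.  For B this is immediate,
    since Y -> (0, Y) is exact and is a section of the second projection.  For
    A an extension of X by M has to become one of (X, 0) by (M, G M).  Pushing
    out, it is equivalent to an extension all of whose terms but the last are
    injective; G keeps that part exact because its derived functors vanish on
    M in the degrees 1 to n, and Ext in the degrees 1 to n+1 is within reach
    of this (Gunit_lift).

    The approximations in B need most of the argument.  In a short exact
    sequence from K to (x, y) to (0, b), the object K has a finite resolution
    by objects of the class D.  Its syzygies inherit enough acyclicity, by a
    fragment of the long exact sequence (acyclic_quotient), for G to be exact
    on the first components; so the structure map of K is epi and its kernel
    has a resolution by objects of N (wedge_Dclass).  As the first component
    of K is isomorphic to x, the second component of K is an extension of
    G x, up to isomorphism, by that kernel, and closure under extensions
    applies.

    Vanishing of derived functors enters only through the inductive notion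
    acyclic.  Part (2) is dual.  The theory of acyclic objects and the kernel
    part of the snake lemma are dualized by passing to opposite categories;
    extensions, whose encoding reads from left to right, are treated anew with
    pullbacks at the right end (pull_chain, Tunit_lift). *)

(** * Diagram chasing with generalized elements *)

Section Chasing.
Variable C : abelian.
Implicit Types X Y Z W : C.

Lemma epi_comp X Y Z (g : Hom Y Z) (f : Hom X Y) : epi g -> epi f -> epi (g ∘ f).
Proof. by move=> hg hf W u v; rewrite !compmA => /hf/hg. Qed.

Lemma mono_comp X Y Z (g : Hom Y Z) (f : Hom X Y) :
  mono g -> mono f -> mono (g ∘ f).
Proof. by move=> hg hf W u v; rewrite -!compmA => /hg/hf. Qed.

Lemma epi_of_comp X Y Z (g : Hom Y Z) (f : Hom X Y) : epi (g ∘ f) -> epi g.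
Proof. by move=> h W u v e; apply: h; rewrite !compmA e. Qed.

Lemma mono_of_comp X Y Z (g : Hom Y Z) (f : Hom X Y) : mono (g ∘ f) -> mono f.
Proof. by move=> h W u v e; apply: h; rewrite -!compmA e. Qed.

Lemma epi_idm X : epi (idm X).
Proof. by move=> W u v; rewrite !compm1. Qed.

Lemma mono_idm X : mono (idm X).
Proof. by move=> W u v; rewrite !comp1m. Qed.

Lemma mono_eq0 X Y W (f : Hom X Y) (u : Hom W X) : mono f -> f ∘ u = 0 -> u = 0.
Proof. by move=> hf e; apply: hf; rewrite e compm0. Qed.

Lemma epi_eq0 X Y W (f : Hom X Y) (u : Hom Y W) : epi f -> u ∘ f = 0 -> u = 0.
Proof. by move=> hf e; apply: hf; rewrite e comp0m. Qed.

(** Epimorphisms are stable under pullback: the kernel of the difference of f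
    and h on the direct sum is the pullback, and the difference, being epi, is
    the cokernel of that kernel. *)
Lemma pullback_epi X Y W (f : Hom X Y) (h : Hom W Y) : epi f ->
  exists (V : C) (p : Hom V W) (l : Hom V X), epi p /\ f ∘ l = h ∘ p.
Proof.
move=> hf; case: (bipP X W) => e1 e2 e3 e4 _.
pose d := f ∘ bpr1 X W - h ∘ bpr2 X W.
have di : d ∘ bin1 X W = f.
  by rewrite /d compDl compNl -!compmA e1 e4 compm0 subr0 compm1.
have dE : epi d by apply: (@epi_of_comp _ _ _ _ (bin1 X W)); rewrite di.
exists (ker d), (bpr2 X W ∘ kermap d), (bpr1 X W ∘ kermap d); split; last first.
  by apply: subr0_eq; rewrite !compmA -compNl -compDl kermap0.
apply: epi0P => U u; rewrite compmA => eu.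
have [t [et _]] := proj2 (epi_is_coker dE) _ _ eu.
have t0 : t = 0 by apply: (epi_eq0 hf); rewrite -di compmA et -compmA e4 compm0.
by rewrite -(compm1 u) -e2 compmA -et t0 !comp0m.
Qed.

(** Surjectivity and exactness may be tested on generalized elements, provided
    that preimages are only asked for after an epimorphic change of the
    source: this is what makes element chasing available. *)
Lemma epiP X Y (f : Hom X Y) :
  epi f <-> forall W (h : Hom W Y),
    exists (V : C) (p : Hom V W) (l : Hom V X), epi p /\ f ∘ l = h ∘ p.
Proof.
split=> [hf W h|]; first exact: pullback_epi.
move/(_ _ (idm Y)) => [V [p [l [hp e]]]]; apply: (@epi_of_comp _ _ _ _ l).
by rewrite e comp1m.
Qed.

Lemma exactP X Y Z (f : Hom X Y) (g : Hom Y Z) :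
  exact f g <-> g ∘ f = 0 /\ forall W (h : Hom W Y), g ∘ h = 0 ->
    exists (V : C) (p : Hom V W) (l : Hom V X), epi p /\ f ∘ l = h ∘ p.
Proof.
split=> [[e he]|[e he]].
  split=> // W h eh; have [V [p [l [hp el]]]] := pullback_epi (ker_lift eh) he.
  by exists V, p, l; split=> //; rewrite -(ker_liftE e) -compmA el compmA ker_liftE.
exists e; have [V [p [l [hp el]]]] := he _ _ (kermap0 g).
apply: (@epi_of_comp _ _ _ _ l).
suff -> : ker_lift e ∘ l = p by [].
by apply: (@kermap_mono _ _ _ g); rewrite compmA ker_liftE.
Qed.

Lemma exact_comp0 X Y Z (f : Hom X Y) (g : Hom Y Z) : exact f g -> g ∘ f = 0.
Proof. by case. Qed.

Lemma exact_lift X Y Z (f : Hom X Y) (g : Hom Y Z) : exact f g ->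
  forall W (h : Hom W Y), g ∘ h = 0 ->
    exists (V : C) (p : Hom V W) (l : Hom V X), epi p /\ f ∘ l = h ∘ p.
Proof. by case/exactP. Qed.

(** In an exact sequence the cokernel of one arrow embeds into the target of
    the next: long exact sequences decompose into short ones. *)
Lemma cokernel_desc_mono W X Y Z (f : Hom W X) (g : Hom X Y) (c : Hom X Z)
    (m : Hom Z Y) : exact f g -> is_cokernel f c -> m ∘ c = g -> mono m.
Proof.
move=> hfg hc em; apply: mono0P => V u eu.
have [V1 [q [l [hq el]]]] := pullback_epi u (cokernel_epi hc).
have gl : g ∘ l = 0 by rewrite -em -compmA el compmA eu comp0m.
have [V2 [q' [l' [hq' el']]]] := exact_lift hfg gl.
apply: (epi_eq0 (epi_comp hq hq')).
by rewrite compmA -el -compmA -el' compmA (proj1 hc) comp0m.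
Qed.

Lemma kernel_exact K X Y (k : Hom K X) (f : Hom X Y) : is_kernel f k -> exact k f.
Proof. by move=> h; apply: (exact_ker h (@epi_idm _)); rewrite compm1. Qed.

Lemma cokernel_exact K X Y (c : Hom Y K) (f : Hom X Y) :
  is_cokernel f c -> exact f c.
Proof. by move=> h; apply: (exact_coker h (@mono_idm _)); rewrite comp1m. Qed.

Lemma short_exactP X Y Z (f : Hom X Y) (g : Hom Y Z) :
  short_exact f g <-> [/\ mono f, exact f g & epi g].
Proof.
split=> [[a b c]|[a b c]]; split=> //.
- exact: exact0_mono.
- exact: exact0_epi.
- exact: mono_exact0.
- exact: epi_exact0.
Qed.

Lemma short_exact_coker X Y (f : Hom X Y) : mono f -> short_exact f (cokermap f).
Proof.
move=> hf; apply/short_exactP; split=> //; last exact: cokermap_epi.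
exact: cokernel_exact (cokermapP f).
Qed.

Lemma short_exact_ker X Y (f : Hom X Y) : epi f -> short_exact (kermap f) f.
Proof.
move=> hf; apply/short_exactP; split=> //; first exact: kermap_mono.
exact: kernel_exact (kermapP f).
Qed.

Lemma exact_factor X Y Z W (f : Hom X Y) (g : Hom Y Z) (h : Hom W Y) :
  exact f g -> mono f -> g ∘ h = 0 -> exists u : Hom W X, f ∘ u = h.
Proof.
move=> hfg hf /(proj2 (exact_mono_kernel hfg hf)) [u [eu _]].
by exists u.
Qed.

Lemma exact_cofactor X Y Z W (f : Hom X Y) (g : Hom Y Z) (h : Hom Y W) :
  exact f g -> epi g -> h ∘ f = 0 -> exists u : Hom Z W, u ∘ g = h.
Proof.
move=> hfg hg /(proj2 (exact_epi_cokernel hfg hg)) [u [eu _]].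
by exists u.
Qed.

Lemma exact_comp_mono X Y Z W (f : Hom X Y) (g : Hom Y Z) (m : Hom Z W) :
  mono m -> exact f (m ∘ g) <-> exact f g.
Proof.
move=> hm; split=> /exactP [e h]; apply/exactP; split=> [|V u eu].
- by apply: (mono_eq0 hm); rewrite compmA.
- by apply: h; rewrite -compmA eu compm0.
- by rewrite -compmA e compm0.
- by apply: h; apply: (mono_eq0 hm); rewrite compmA.
Qed.

Lemma exact_comp_epi V X Y Z (p : Hom V X) (f : Hom X Y) (g : Hom Y Z) :
  epi p -> exact (f ∘ p) g <-> exact f g.
Proof.
move=> hp; split=> /exactP [e h]; apply/exactP; split=> [|W u eu].
- by apply: (epi_eq0 hp); rewrite -compmA.
- have [U [q [l [hq el]]]] := h _ _ eu.
  by exists U, q, (p ∘ l); rewrite compmA.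
- by rewrite compmA e comp0m.
- have [U [q [l [hq el]]]] := h _ _ eu.
  have [U' [q' [l' [hq' el']]]] := pullback_epi l hp.
  exists U', (q ∘ q'), l'; split; first exact: epi_comp.
  by rewrite -compmA el' !compmA el.
Qed.

Lemma mono_epi_iso X Y (f : Hom X Y) : mono f -> epi f ->
  exists g : Hom Y X, g ∘ f = idm X /\ f ∘ g = idm Y.
Proof.
move=> hm he; have [g eg] : exists g, f ∘ g = idm Y.
  apply: exact_factor (epi_exact0 he) hm _; exact: comp0m.
exists g; split=> //; apply: hm; by rewrite compmA eg comp1m compm1.
Qed.

Lemma isomorphic_sym X Y : isomorphic X Y -> isomorphic Y X.
Proof. by move=> [f [g [e1 e2]]]; exists g, f. Qed.

Lemma is_zeroP X : idm X = 0 -> is_zero X.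
Proof.
move=> e Y; split=> f g.
  by rewrite -(compm1 f) -(compm1 g) e !compm0.
by rewrite -(comp1m f) -(comp1m g) e !comp0m.
Qed.

Lemma zero_homr X Y (f : Hom X Y) : is_zero Y -> f = 0.
Proof. by move=> h; apply: (proj2 (h X)). Qed.

Lemma zero_homl X Y (f : Hom X Y) : is_zero X -> f = 0.
Proof. by move=> h; apply: (proj1 (h Y)). Qed.

Lemma zero_epi X Y (f : Hom X Y) : is_zero Y -> epi f.
Proof. by move=> h W u v _; apply: (proj1 (h W)). Qed.

Lemma zero_mono X Y (f : Hom X Y) : is_zero X -> mono f.
Proof. by move=> h W u v _; apply: (proj2 (h W)). Qed.

Lemma zero_isomorphic X Y : is_zero X -> is_zero Y -> isomorphic X Y.
Proof.
by move=> hX hY; exists 0, 0; split; [exact: (proj1 (hX X)) | exact: (proj1 (hY Y))].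
Qed.

Lemma is_zero_bip X Y : is_zero X -> is_zero Y -> is_zero (bip X Y).
Proof.
move=> hX hY; apply: is_zeroP; case: (bipP X Y) => _ _ _ _ <-.
by rewrite (zero_homr (bpr1 X Y) hX) (zero_homr (bpr2 X Y) hY) !compm0 addr0.
Qed.

Lemma exact_zero X Y Z (f : Hom X Y) (g : Hom Y Z) :
  is_zero Y -> exact f g.
Proof.
move=> h; apply/exactP; split=> [|W u _]; first by rewrite (zero_homl g h) comp0m.
by exists W, (idm W), 0; split; [exact: epi_idm | rewrite (zero_homr u h) comp0m compm0].
Qed.

End Chasing.

(** * Opposite categories *)

Definition op_pre (C : preadditive) : preadditive.
Proof.
refine (@Preadditive C (fun X Y => @Hom C Y X) (@idm C)
  (fun X Y Z g f => f ∘ g) _ _ _ _ _).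
- by move=> X Y f; rewrite compm1.
- by move=> X Y f; rewrite comp1m.
- by move=> W X Y Z h g f; rewrite compmA.
- by move=> X Y Z g g' f; rewrite compDr.
- by move=> X Y Z g f f'; rewrite compDl.
Defined.

Lemma op_bipP (C : abelian) (X Y : C) : @is_biproduct (op_pre C) X Y (bip X Y)
  (bpr1 X Y) (bpr2 X Y) (bin1 X Y) (bin2 X Y).
Proof. by case: (bipP X Y) => ? ? ? ? ?; split. Qed.

Lemma op_zobP (C : abelian) : @is_zero (op_pre C) (zob : C).
Proof. by move=> X; split; [exact: (proj2 (zobP X)) | exact: (proj1 (zobP X))]. Qed.

Definition op (C : abelian) : abelian :=
  @Abelian (op_pre C) zob (@op_zobP C) bip _ _ _ _ (@op_bipP C)
    (fun X Y (f : @Hom C Y X) => coker f) (fun X Y f => cokermap f)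
    (fun X Y f => cokermapP f)
    (fun X Y (f : @Hom C Y X) => ker f) (fun X Y f => kermap f)
    (fun X Y f => kermapP f)
    (fun X Y f => @epi_normal C Y X f) (fun X Y f => @mono_normal C Y X f).

(** Exactness is defined through kernels; that it is self-dual says that
    image and coimage agree. *)
Lemma exact_op (C : abelian) (X Y Z : C) (f : Hom X Y) (g : Hom Y Z) :
  exact f g -> @exact (op C) Z Y X g f.
Proof.
move=> h; have e := exact_comp0 h.
pose m := coker_desc e; have em : m ∘ cokermap f = g := coker_descE e.
have hm : mono m := cokernel_desc_mono h (cokermapP f) em.
exact: (@exact_ker (op C) Z Y X (coker f) g f (cokermap f) m (cokermapP f)).
Qed.

Lemma op_exact (C : abelian) (X Y Z : C) (f : Hom X Y) (g : Hom Y Z) :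
  @exact (op C) Z Y X g f -> exact f g.
Proof. exact: (@exact_op (op C) Z Y X g f). Qed.

Lemma short_exact_op (C : abelian) (X Y Z : C) (f : Hom X Y) (g : Hom Y Z) :
  short_exact f g <-> @short_exact (op C) Z Y X g f.
Proof.
split=> /short_exactP [a b c]; apply/short_exactP; split=> //.
- exact: exact_op.
- exact: op_exact.
Qed.

Lemma op_injective (C : abelian) (P : C) : projective P -> @injective_ob (op C) P.
Proof. by move=> hP X Y i f; apply: (hP Y X). Qed.

Lemma op_enough_injectives (C : abelian) :
  enough_projectives C -> enough_injectives (op C).
Proof.
by move=> h X; have [P [p [hP hp]]] := h X; exists P, p; split=> //; apply: op_injective.
Qed.

Definition op_functor (C D : abelian) (F : functor C D) : functor (op C) (op D).
Proof.
refine (@Functor (op C) (op D) F (fun X Y (f : @Hom C Y X) => fmap F f) _ _ _).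
- by move=> X; apply: (fmap1 F).
- by move=> X Y Z g f; apply: (fmapM F).
- by move=> X Y f g; apply: (fmapD F).
Defined.

Lemma op_left_exact (C D : abelian) (F : rightExactFunctor C D) :
  left_exact (op_functor F).
Proof.
move=> X Y Z f g /exact0_mono hf /op_exact hfg.
have [h1 h2] := rfunP F hfg (@epi_exact0 C Y X f hf).
split; last exact: exact_op h1.
by apply: (@mono_exact0 (op D)); exact: (@exact0_epi D _ _ _ h2).
Qed.

Definition op_rfun (C D : abelian) (F : rightExactFunctor C D) :
  leftExactFunctor (op C) (op D) := LeftExactFunctor (op_left_exact F).


(** * Acyclic objects of a left exact functor *)

Section ThreeByThree.
Variable C : abelian.

(** A morphism of short exact sequences which is the identity on the left end
    makes the right-hand square a pullback.  Writing the pullback as a kernel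
    lets left exact functors preserve it. *)
Lemma pullback_kernel (V E Z I Q : C) (f : Hom V E) (g : Hom E Z)
    (i : Hom V I) (p : Hom I Q) (e : Hom E I) (w : Hom Z Q) :
  exact f g -> epi g -> mono i -> exact i p -> e ∘ f = i -> w ∘ g = p ∘ e ->
  is_kernel (p ∘ bpr1 I Z - w ∘ bpr2 I Z) (bin1 I Z ∘ e + bin2 I Z ∘ g).
Proof.
move=> hfg hg hi hip ef ew; case: (bipP I Z) => e1 e2 e3 e4 e5.
set d := _ - _; set k := _ + _.
have k1 : bpr1 I Z ∘ k = e.
  by rewrite compDr !compmA e1 e3 comp1m comp0m addr0.
have k2 : bpr2 I Z ∘ k = g.
  by rewrite compDr !compmA e2 e4 comp1m comp0m add0r.
have dk : d ∘ k = 0 by rewrite compDl compNl -!compmA k1 k2 ew subrr.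
have km : mono k.
  apply: mono0P => W u eu.
  have gu : g ∘ u = 0 by rewrite -k2 -compmA eu compm0.
  have [V' [q [l [hq el]]]] := exact_lift hfg gu.
  have l0 : l = 0.
    by apply: (mono_eq0 hi); rewrite -ef -compmA el -k1 -!compmA (compmA k) eu comp0m compm0.
  by apply: (epi_eq0 hq); rewrite -el l0 compm0.
apply: exact_mono_kernel => //; apply/exactP; split=> // W h eh.
have [V1 [q [l [hq el]]]] := pullback_epi (bpr2 I Z ∘ h) hg.
have pe : p ∘ (e ∘ l - bpr1 I Z ∘ h ∘ q) = 0.
  rewrite compDr compNr compmA -ew -compmA el.
  have : d ∘ h ∘ q = 0 by rewrite eh comp0m.
  rewrite /d !compDl !compNl -!compmA => /subr0_eq ->.
  by rewrite subrr.
have [v ev] := exact_factor hip hi pe.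
exists V1, q, (l - f ∘ v); split=> //.
rewrite -[RHS]comp1m -e5 compDl -!compmA [k ∘ _]compDl -!compmA.
rewrite !compDr !compNr (compmA e) ef (compmA g) (exact_comp0 hfg) comp0m compm0.
rewrite subr0 el ev compDr compNr -!compmA.
by rewrite subKr.
Qed.

(** A 3x3 lemma.  The morphism with components a and b maps D to K (+) J, and
    the image of f, which is the kernel of a, to the summand J; passing to cokernels turns the split
    sequence J, K (+) J, K into the sequence Q, S, R. *)
Lemma cone_short_exact (V D K J P R Q S : C)
    (in1 : Hom K P) (in2 : Hom J P) (pr1 : Hom P K) (pr2 : Hom P J)
    (f : Hom V D) (a : Hom D K) (p : Hom K R) (b : Hom D J)
    (q : Hom J Q) (s : Hom P S) :
  is_biproduct in1 in2 pr1 pr2 ->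
  exact f a -> exact a p -> epi p -> exact (b ∘ f) q -> epi q ->
  exact (in1 ∘ a + in2 ∘ b) s -> epi s ->
  exists (u : Hom Q S) (v : Hom S R),
    [/\ u ∘ q = s ∘ in2, v ∘ s = p ∘ pr1 & short_exact u v].
Proof.
move=> [e1 e2 e3 e4 e5] hfa hap hp hbq hq hcs hs.
set c := _ + _ in hcs.
have c1 : pr1 ∘ c = a by rewrite compDr !compmA e1 e3 comp1m comp0m addr0.
have c2 : pr2 ∘ c = b by rewrite compDr !compmA e2 e4 comp1m comp0m add0r.
have sc := exact_comp0 hcs.
have sb : s ∘ in2 ∘ (b ∘ f) = 0.
  have -> : s ∘ in2 ∘ (b ∘ f) = s ∘ c ∘ f - s ∘ in1 ∘ (a ∘ f).
    by rewrite compDr compDl !compmA addrC addKr.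
  by rewrite sc (exact_comp0 hfa) comp0m compm0 subrr.
have [u eu] := exact_cofactor hbq hq sb.
have pc : p ∘ pr1 ∘ c = 0 by rewrite -compmA c1 (exact_comp0 hap).
have [v ev] := exact_cofactor hcs hs pc.
exists u, v; split=> //; apply/short_exactP; split.
- apply: mono0P => W x ex.
  have [W1 [q1 [l [hq1 el]]]] := pullback_epi x hq.
  have sl : s ∘ (in2 ∘ l) = 0 by rewrite compmA -eu -compmA el compmA ex comp0m.
  have [W2 [q2 [t [hq2 et]]]] := exact_lift hcs sl.
  have at0 : a ∘ t = 0 by rewrite -c1 -compmA et !compmA e3 !comp0m.
  have [W3 [q3 [y [hq3 ey]]]] := exact_lift hfa at0.
  have lb : l ∘ q2 = b ∘ t by rewrite -c2 -compmA et !compmA e2 comp1m.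
  apply: (epi_eq0 (epi_comp (epi_comp hq1 hq2) hq3)).
  rewrite !compmA -el -(compmA q) lb -!compmA -ey (compmA b) compmA.
  by rewrite (exact_comp0 hbq) comp0m.
- apply/exactP; split=> [|W x ex].
    by apply: (epi_eq0 hq); rewrite -compmA eu compmA ev -compmA e3 compm0.
  have [W1 [q1 [l [hq1 el]]]] := pullback_epi x hs.
  have pl : p ∘ (pr1 ∘ l) = 0 by rewrite compmA -ev -compmA el compmA ex comp0m.
  have [W2 [q2 [t [hq2 et]]]] := exact_lift hap pl.
  exists W2, (q1 ∘ q2), (q ∘ (pr2 ∘ (l ∘ q2 - c ∘ t))).
  split; first exact: epi_comp.
  rewrite compmA eu -compmA (compmA in2).
  have -> : in2 ∘ pr2 = idm P - in1 ∘ pr1 by rewrite -e5 addrC addKr.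
  rewrite compDl comp1m compNl -compmA (compDr pr1) compNr (compmA pr1 c) c1 et.
  rewrite -(compmA pr1) subrr compm0 subr0 compDr compNr !compmA sc comp0m subr0.
  by rewrite el.
- apply: (@epi_of_comp _ _ _ _ _ s); rewrite ev; apply: epi_comp => //.
  by apply: (@epi_of_comp _ _ _ _ _ in1); rewrite e1; apply: epi_idm.
Qed.

Lemma biproduct_swap (X Y P : C) (in1 : Hom X P) (in2 : Hom Y P)
    (pr1 : Hom P X) (pr2 : Hom P Y) :
  is_biproduct in1 in2 pr1 pr2 -> is_biproduct in2 in1 pr2 pr1.
Proof. by case=> ? ? ? ? e; split=> //; rewrite addrC. Qed.

Lemma injective_bip (I J : C) :
  injective_ob I -> injective_ob J -> injective_ob (bip I J).
Proof.
move=> hI hJ X Y i f hi; case: (bipP I J) => e1 e2 e3 e4 e5.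
have [g eg] := hI _ _ i (bpr1 I J ∘ f) hi.
have [h eh] := hJ _ _ i (bpr2 I J ∘ f) hi.
exists (bin1 I J ∘ g + bin2 I J ∘ h).
by rewrite compDl -!compmA eg eh !compmA -compDl e5 comp1m.
Qed.

End ThreeByThree.

Section Acyclic.
Variables (A B : abelian) (G : leftExactFunctor A B) (hI : enough_injectives A).

(** When A has enough injectives this is the vanishing of the right derived
    functors of G on V in the degrees 1 to k, by dimension shifting.
    Quantifying over all embeddings into injective objects makes the condition
    independent of choices. *)
Fixpoint acyclic k (V : A) : Prop :=
  if k is j.+1 then
    forall (I Z : A) (i : Hom V I) (p : Hom I Z),
      injective_ob I -> short_exact i p -> epi (fmap G p) /\ acyclic j Z
  else True.

Lemma lfun_exact (X Y Z : A) (f : Hom X Y) (g : Hom Y Z) :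
  mono f -> exact f g -> exact (fmap G f) (fmap G g).
Proof. by move=> hf hfg; apply/kernel_exact/lfun_ker/exact_mono_kernel. Qed.

Lemma injective_embedding (V : A) : exists (I : A) (i : Hom V I),
  injective_ob I /\ short_exact i (cokermap i).
Proof.
have [I [i [hIi hi]]] := hI V.
by exists I, i; split=> //; apply: short_exact_coker.
Qed.

(** Acyclicity in degree 1 is tested on injective objects, but any extension
    of V is pulled back from one with an injective middle term, and G preserves
    that pullback. *)
Lemma acyclic_epi k (V E Z : A) (f : Hom V E) (g : Hom E Z) :
  acyclic k.+1 V -> short_exact f g -> epi (fmap G g).
Proof.
move=> hV /short_exactP [hf hfg hg].
have [I [i [hIi hs]]] := injective_embedding V.
have [hGp _] := hV _ _ _ _ hIi hs.
move/short_exactP: hs => [hi hip hp].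
have [e ef] := hIi _ _ f i hf.
have [w ew] : exists w, w ∘ g = cokermap i ∘ e.
  by apply: exact_cofactor hfg hg _; rewrite -compmA ef cokermap0.
have hk := lfun_ker G (pullback_kernel hfg hg hi hip ef ew).
case: (bipP I Z) => e1 e2 e3 e4 e5.
apply/epiP => S h.
have [W [q [l [hq el]]]] := pullback_epi (fmap G w ∘ h) hGp.
have e0 : fmap G (cokermap i ∘ bpr1 I Z - w ∘ bpr2 I Z) ∘
    (fmap G (bin1 I Z) ∘ l + fmap G (bin2 I Z) ∘ (h ∘ q)) = 0.
  have d1 : (cokermap i ∘ bpr1 I Z - w ∘ bpr2 I Z) ∘ bin1 I Z = cokermap i.
    by rewrite compDl compNl -!compmA e1 e4 compm0 subr0 compm1.
  have d2 : (cokermap i ∘ bpr1 I Z - w ∘ bpr2 I Z) ∘ bin2 I Z = - w.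
    by rewrite compDl compNl -!compmA e2 e3 compm0 add0r compm1.
  rewrite compDr (compmA _ _ l) (compmA _ _ (h ∘ q)) -!fmapM d1 d2 el -compmA.
  by rewrite -compDl -fmapD subrr fmap0 comp0m.
have [t [et _]] := proj2 hk _ _ e0.
exists W, q, t; split=> //.
have /(congr1 (fun x => fmap G (bpr2 I Z) ∘ x)) := et.
rewrite !compDr !compmA -!fmapM !compDr !compmA e2 e4 !comp0m !comp1m fmap0 fmap1.
by rewrite comp0m !comp1m !add0r.
Qed.

Lemma acyclicW k (V : A) : acyclic k.+1 V -> acyclic k V.
Proof.
elim: k V => // k IHk V hV I Z i p hIi hs.
by have [h1 h2] := hV _ _ _ _ hIi hs; split=> //; apply: IHk.
Qed.

Lemma acyclic_le j k (V : A) : (j <= k)%N -> acyclic k V -> acyclic j V.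
Proof.
move/subnK <-; elim: (k - j)%N => // m IHm; rewrite addSn => /acyclicW.
exact: IHm.
Qed.

(** The part of the long exact sequence of derived functors saying that
    derived functors vanish on W in the degrees 1 to k if they vanish on C in
    these degrees and on V in the degrees 2 to k+1.  An embedding of W into K
    and one of C into J embed C into K (+) J, and the cokernels again form a
    short exact sequence, to which induction applies. *)
Lemma acyclic_quotient k (V C W : A) (f : Hom V C) (g : Hom C W) :
  short_exact f g -> acyclic k.+1 V -> acyclic k C -> acyclic k W.
Proof.
elim: k V C W f g => // k IHk V C W f g /short_exactP [hf hfg hg] hV hC.
move=> K R i p hK /short_exactP [hi hip hp].
have [J [j [hJ /short_exactP [hj _ _]]]] := injective_embedding C.
pose c := bin1 K J ∘ (i ∘ g) + bin2 K J ∘ j.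
have hc : mono c.
  case: (bipP K J) => e1 e2 e3 e4 _; apply: (@mono_of_comp _ _ _ _ (bpr2 K J)).
  by rewrite compDr !compmA e2 e4 !comp0m comp1m add0r.
have sQ := short_exact_coker (mono_comp hj hf).
have sS := short_exact_coker hc.
have [_ hQ] := hV _ _ _ _ hJ sQ.
have [eS hS] := hC _ _ _ _ (injective_bip hK hJ) sS.
have fa : exact f (i ∘ g) by apply/exact_comp_mono.
have ap : exact (i ∘ g) p by apply/exact_comp_epi.
case/short_exactP: sQ => _ bq q_epi; case/short_exactP: sS => _ cs s_epi.
have [u [v [eu ev hs]]] := cone_short_exact (bipP K J) fa ap hp bq q_epi cs s_epi.
split; last exact: IHk hs hQ hS.
apply: (@epi_of_comp _ _ _ _ _ (fmap G (bpr1 K J))).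
by rewrite -fmapM -ev fmapM; apply: epi_comp eS; apply: acyclic_epi hQ hs.
Qed.

Lemma injective_split (I J Z : A) (i : Hom I J) (p : Hom J Z) :
  injective_ob I -> short_exact i p -> exists (r : Hom J I) (s : Hom Z J),
    [/\ r ∘ i = idm I, p ∘ s = idm Z & i ∘ r + s ∘ p = idm J].
Proof.
move=> hIi /short_exactP [hi hip hp].
have [r er] := hIi _ _ i (idm I) hi.
have [s es] : exists s, s ∘ p = idm J - i ∘ r.
  apply: exact_cofactor hip hp _.
  by rewrite compDl compNl comp1m -compmA er compm1 subrr.
exists r, s; split=> //; last by rewrite es addrC subrK.
apply: hp; rewrite -compmA es compDr compNr compmA (exact_comp0 hip) comp0m subr0.
by rewrite compm1 comp1m.
Qed.

Lemma injective_acyclic k (I : A) : injective_ob I -> acyclic k I.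
Proof.
elim: k I => // k IHk I hIi J Z i p hJ hs.
have [r [s [_ es _]]] := injective_split hIi hs.
split.
  by apply: (@epi_of_comp _ _ _ _ _ (fmap G s)); rewrite -fmapM es fmap1; apply: epi_idm.
apply: IHk => X Y m f hm; have [g eg] := hJ _ _ m (s ∘ f) hm.
by exists (p ∘ g); rewrite -compmA eg compmA es comp1m.
Qed.

(** The sequence splits, so S and Z have the same derived functors in positive
    degrees.  An embedding of S into an injective K restricts to one of Z, and
    the cokernels U and R of Z and S differ by the injective object I. *)
Lemma acyclic_extension k (I S Z : A) (a : Hom I S) (b : Hom S Z) :
  injective_ob I -> short_exact a b -> acyclic k Z -> acyclic k S.
Proof.
case: k => // k hIi hab hZ K R s r hK /short_exactP [hs hsr hr].
have [rho [t [era ebt ert]]] := injective_split hIi hab.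
case/short_exactP: hab => ha hab hb.
have ht : mono t.
  by apply: (@mono_of_comp _ _ _ _ b); rewrite ebt; apply: mono_idm.
have hU := short_exact_coker (mono_comp hs ht).
have [eU aU] := hZ _ _ _ _ hK hU.
case/short_exactP: hU => _ hst hc; set c := cokermap _ in hst hc eU.
have [v ev] : exists v, v ∘ c = r.
  by apply: exact_cofactor hst hc _; rewrite compmA (exact_comp0 hsr) comp0m.
have hIUR : short_exact (c ∘ s ∘ a) v.
  apply/short_exactP; split.
  - apply: mono0P => W u eu.
    have [|W1 [q [l [hq el]]]] := exact_lift hst (h := s ∘ a ∘ u).
      by rewrite !compmA.
    have ea : a ∘ (u ∘ q) = t ∘ l by apply: hs; rewrite !compmA el.
    have l0 : l = 0.
      by rewrite -(comp1m l) -ebt -compmA -ea compmA (exact_comp0 hab) comp0m.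
    by apply: (epi_eq0 hq); apply: (mono_eq0 ha); rewrite ea l0 compm0.
  - apply/exactP; split=> [|W u eu].
      by rewrite !compmA ev (exact_comp0 hsr) comp0m.
    have [W1 [q [l [hq el]]]] := pullback_epi u hc.
    have rl : r ∘ l = 0 by rewrite -ev -compmA el compmA eu comp0m.
    have [m em] := exact_factor hsr hs rl.
    exists W1, q, (rho ∘ m); split=> //; rewrite -el -em.
    rewrite -[in RHS](comp1m m) -ert compDl !compDr.
    rewrite -(compmA t) (compmA s t) (compmA c (s ∘ t)) (exact_comp0 hst) comp0m addr0.
    by rewrite !compmA.
  - by apply: (@epi_of_comp _ _ _ _ _ c); rewrite ev.
split; last exact: acyclic_quotient hIUR (injective_acyclic k.+1 hIi) aU.
rewrite -ev fmapM; apply: epi_comp eU.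
exact: acyclic_epi (injective_acyclic 1 hIi) hIUR.
Qed.

(** One embedding suffices: two embeddings of V have the common refinement S,
    the cokernel of V -> I (+) I'. *)
Lemma acyclic_intro k (V I Z : A) (i : Hom V I) (p : Hom I Z) :
  injective_ob I -> short_exact i p -> epi (fmap G p) -> acyclic k Z ->
  acyclic k.+1 V.
Proof.
move=> hIi /short_exactP [hi hip hp] hGp hZ I' Z' i' p' hI' /short_exactP [hi' hip' hp'].
have hb := bipP I I'; pose c := bin1 I I' ∘ i + bin2 I I' ∘ i'.
have s_epi : epi (cokermap c) := @cokermap_epi _ _ _ _.
have cs : exact c (cokermap c) := cokernel_exact (cokermapP c).
have [|u [v [eu ev hs]]] := cone_short_exact hb (mono_exact0 hi) hip hp (b := i')
  (q := idm I') _ (@epi_idm _ _) cs s_epi.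
  by rewrite compm0; apply/mono_exact0/mono_idm.
have cs' : exact (bin2 I I' ∘ i' + bin1 I I' ∘ i) (cokermap c) by rewrite addrC.
have [|u' [v' [eu' ev' hs']]] := cone_short_exact (biproduct_swap hb)
  (mono_exact0 hi') hip' hp' (b := i) (q := idm I) _ (@epi_idm _ _) cs' s_epi.
  by rewrite compm0; apply/mono_exact0/mono_idm.
have hS := acyclic_extension hI' hs hZ.
split; last exact: acyclic_quotient hs' (injective_acyclic k.+1 hIi) hS.
have eGv' := acyclic_epi (injective_acyclic 1 hIi) hs'.
apply: (@epi_of_comp _ _ _ _ _ (fmap G (bpr2 I I'))).
rewrite -fmapM -ev' fmapM; apply: epi_comp eGv' _.
have [rho [t [_ evt ert]]] := injective_split hI' hs.
(* S splits as I' (+) Z, and both summands are covered by G (I (+) I') *)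
apply/epiP => W h.
have [W1 [q [l [hq el]]]] := pullback_epi (fmap G v ∘ h) hGp.
pose h1 := fmap G (bin1 I I') ∘ l.
have e0 : fmap G v ∘ (h ∘ q - fmap G (cokermap c) ∘ h1) = 0.
  case: hb => e1 _ _ _ _; rewrite compDr compNr compmA -el.
  rewrite (compmA _ _ h1) -fmapM ev /h1 (compmA _ _ l) -fmapM -compmA e1 compm1.
  by rewrite subrr.
case/short_exactP: hs => hu huv hv.
have [m em] := exact_factor (lfun_exact hu huv) (lfun_mono hu) e0.
exists W1, q, (h1 + fmap G (bin2 I I') ∘ m); split=> //.
by rewrite compDr (compmA _ _ m) -fmapM -eu compm1 em addrC subrK.
Qed.

(** The first cosyzygy of V has the resolution R with its first term dropped. *)
Lemma acyclic_resolution k (V : A) (R : inj_resolution V) :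
  (forall j, (j < k)%N -> exact (fmap G (ird R j)) (fmap G (ird R j.+1))) ->
  acyclic k V.
Proof.
elim: k V R => // k IHk V R hR.
have ha := exact0_mono (ir_exact_aug R); have hs := short_exact_coker ha.
pose c := cokermap (iraug R); have hc : epi c by apply: cokermap_epi.
have e0 := exact_comp0 (ir_exact0 R).
pose a := coker_desc e0; have ea : a ∘ c = ird R 0 := coker_descE e0.
have hm : mono a := cokernel_desc_mono (ir_exact0 R) (cokermapP _) ea.
have hx : exact a (ird R 1).
  by apply/(exact_comp_epi _ _ hc); rewrite ea; apply: ir_exact.
pose R' := @InjResolution A _ (fun j => R j.+1) (fun j => ird R j.+1) a
  (fun j => @ir_inj _ _ R j.+1) (fun j => @ir_exact _ _ R j.+1) hx (mono_exact0 hm).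
apply: acyclic_intro (@ir_inj _ _ R 0) hs _ (IHk _ R' (fun j => hR j.+1)).
apply/epiP => W h.
have [|W1 [q [l [hq el]]]] := exact_lift (hR 0%N isT) (h := fmap G a ∘ h).
  by rewrite compmA -fmapM (exact_comp0 hx) fmap0 comp0m.
exists W1, q, l; split=> //; apply: (lfun_mono hm).
by rewrite compmA -fmapM ea el compmA.
Qed.

Lemma homology_zero_exact (X Y Z : B) (f : Hom X Y) (g : Hom Y Z) (e : g ∘ f = 0) :
  is_zero (homology e) -> exact f g.
Proof.
move=> h; exists e; apply: epi0P => W u eu.
by rewrite -(coker_descE eu) (zero_homr (cokermap _) h) compm0.
Qed.

End Acyclic.

(** Derived functors are computed with one chosen resolution; the next two
    lemmas pass from them to choice-free acyclicity. *)
Lemma right_derived_acyclic (A B : abelian) (hI : enough_injectives A)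
    (G : leftExactFunctor A B) n (V : A) :
  (forall j, (1 <= j <= n)%N -> is_zero (right_derived hI G j V)) ->
  acyclic G n V.
Proof.
move=> h; apply: (acyclic_resolution hI (R := the_inj_resolution hI V)) => j hj.
exact: (@homology_zero_exact _ _ _ _ _ _ (fmap_comp0 G (ird0 _ j)) (h j.+1 hj)).
Qed.

Lemma left_derived_acyclic (A B : abelian) (hP : enough_projectives B)
    (T : rightExactFunctor B A) n (V : B) :
  (forall j, (1 <= j <= n)%N -> is_zero (left_derived hP T j V)) ->
  @acyclic (op B) (op A) (op_rfun T) n V.
Proof.
move=> h; pose P := the_proj_resolution hP V.
pose R := @InjResolution (op B) V P (fun j => prd P j) (praug P) 
  (fun j => op_injective (@pr_proj _ _ P j))
  (fun j => exact_op (@pr_exact _ _ P j)) (exact_op (pr_exact0 P))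
  (@mono_exact0 (op B) _ _ _ (exact0_epi (pr_exact_aug P))).
apply: (@acyclic_resolution (op B) (op A) (op_rfun T) (op_enough_injectives hP) n V R) => j hj.
apply: exact_op.
exact: (@homology_zero_exact _ _ _ _ _ _ (fmap_comp0 T (prd0 _ j)) (h j.+1 hj)).
Qed.

(** * Pushouts and pullbacks *)

Section Pushout.
Variable C : abelian.
Implicit Types W X Y Z E : C.

Lemma pushout_mono W E Z (a : Hom W E) (w : Hom W Z) : mono a ->
  exists (Q : C) (i1 : Hom Z Q) (i2 : Hom E Q),
    [/\ mono i1, i1 ∘ w = i2 ∘ a, epi (i1 ∘ bpr1 Z E + i2 ∘ bpr2 Z E)
      & forall V (f : Hom Z V) (g : Hom E V), f ∘ w = g ∘ a ->
          exists h : Hom Q V, h ∘ i1 = f /\ h ∘ i2 = g].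
Proof.
move=> ha; case: (bipP Z E) => e1 e2 e3 e4 e5.
pose c := bin1 Z E ∘ w - bin2 Z E ∘ a; pose k := cokermap c.
have c1 : bpr1 Z E ∘ c = w.
  by rewrite compDr compNr !compmA e1 e3 comp0m subr0 comp1m.
have c2 : bpr2 Z E ∘ c = - a.
  by rewrite compDr compNr !compmA e2 e4 comp0m add0r comp1m.
exists (coker c), (k ∘ bin1 Z E), (k ∘ bin2 Z E); split.
- apply: mono0P => U u; rewrite -compmA.
  move/(exact_lift (cokernel_exact (cokermapP c))) => [V [p [l [hp el]]]].
  have l0 : l = 0.
    apply: (mono_eq0 ha); apply: oppr_inj.
    by rewrite oppr0 -compNl -c2 -compmA el !compmA e4 !comp0m.
  apply: (epi_eq0 hp).
  by rewrite -(comp1m (u ∘ p)) -e1 -compmA (compmA (bin1 Z E)) -el l0 !compm0.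
- by apply: subr0_eq; rewrite -!compmA -compNr -compDr cokermap0.
- by rewrite -!compmA -compDr e5 compm1; apply: cokermap_epi.
- move=> V f g efg; have [|h [eh _]] := proj2 (cokermapP c) V (f ∘ bpr1 Z E + g ∘ bpr2 Z E).
    by rewrite compDl -!compmA c1 c2 compNr efg subrr.
  exists h; rewrite !compmA eh !compDl -!compmA e1 e2 e3 e4.
  by rewrite !compm1 !compm0 addr0 add0r.
Qed.

End Pushout.

Lemma kernel_lift_epi (C : abelian) (W X Y Z : C) (f : Hom W X) (g : Hom X Y) (k : Hom Z X)
    (p : Hom W Z) : exact f g -> is_kernel g k -> k ∘ p = f -> epi p.
Proof.
by move=> /exact_op hfg hk e; apply: (@cokernel_desc_mono (op C) Y X W Z g f k p hfg hk e).
Qed.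

Lemma pullback_epi_square (C : abelian) (E L K : C) (b : Hom E L) (w : Hom K L) : epi b ->
  exists (Q : C) (p1 : Hom Q K) (p2 : Hom Q E),
    [/\ epi p1, w ∘ p1 = b ∘ p2, mono (bin1 K E ∘ p1 + bin2 K E ∘ p2)
      & forall (V : C) (f : Hom V K) (g : Hom V E), w ∘ f = b ∘ g ->
          exists h : Hom V Q, p1 ∘ h = f /\ p2 ∘ h = g].
Proof. exact: (@pushout_mono (op C) L E K b w). Qed.

(** * Splicing exact sequences *)

Section Splicing.
Variable C : abelian.
Implicit Types W X Y Z E I K L : C.

Definition precomp n X Z W (q : Hom W X) : chain n X Z -> chain n W Z :=
  match n with
  | 0 => fun c => (c : Hom X Z) ∘ q
  | m.+1 => fun c => existT _ (projT1 c) ((projT2 c).1 ∘ q, (projT2 c).2)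
  end.

Definition splice_l n Y I Z X (j : Hom Y I) (q : Hom I Z) (c : chain n Z X) :
  chain n.+1 Y X := existT _ I (j, precomp q c).

Fixpoint splice_r n L E X (k : Hom L E) (p : Hom E X) :
    forall Y, chain n Y L -> chain n.+1 Y X :=
  match n with
  | 0 => fun Y c => existT _ E (k ∘ (c : Hom Y L), p)
  | m.+1 => fun Y c => existT _ (projT1 c) ((projT2 c).1, splice_r k p (projT2 c).2)
  end.

Lemma exact_from_epi n V W X Z (q : Hom V W) (f : Hom W X) (c : chain n X Z) :
  epi q -> exact_from (f ∘ q) c <-> exact_from f c.
Proof.
case: n c => [|n] c hq; split=> -[h1 h2]; split=> //.
all: exact/(exact_comp_epi _ _ hq).
Qed.

Lemma exact_from_zero n W W' X Z (c : chain n X Z) :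
  exact_from (0 : Hom W X) c -> exact_from (0 : Hom W' X) c.
Proof.
have h (V : C) (g : Hom X V) : exact (0 : Hom W X) g -> exact (0 : Hom W' X) g.
  move=> /exactP [_ hg]; have : mono g.
    apply: mono0P => U u /hg [U' [p [l [hp el]]]].
    by apply: (epi_eq0 hp); rewrite -el comp0m.
  move=> hm; apply/exactP; split=> [|U u eu]; first by rewrite compm0.
  exists U, (idm U), 0; split; first exact: epi_idm.
  by rewrite (mono_eq0 hm eu) !comp0m.
by case: n c => [|n] c [h1 h2]; split=> //; apply: h.
Qed.

Lemma exact_chain0 X Z (c : chain 0 X Z) : exact_chain c -> isomorphic X Z.
Proof.
by case=> /exact0_mono hm /exact0_epi he; have [g [e1 e2]] := mono_epi_iso hm he;
  exists c, g.
Qed.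

Lemma exact_chain_idm X : @exact_chain C 0 X X (idm X).
Proof. by split; [apply/mono_exact0/mono_idm | apply/epi_exact0/epi_idm]. Qed.

Lemma exact_splice_l n Y I Z X (j : Hom Y I) (q : Hom I Z) (c : chain n Z X) :
  short_exact j q -> exact_chain c -> exact_chain (splice_l j q c).
Proof.
move=> [h0 hjq /exact0_epi hq]; case: n c => [|n] c [/exact0_mono hm hc]; split=> //.
  by split; [apply/exact_comp_mono | apply/(exact_comp_epi _ _ hq)].
by split; [apply/exact_comp_mono | apply/exact_from_epi].
Qed.

(** Cutting at either end.  The results are equalities of chains, so that any
    statement about chains may be proved for splices only. *)
Lemma unsplice_l n Y X (c : chain n.+1 Y X) : exact_chain c ->
  exists I Z (j : Hom Y I) (q : Hom I Z) (c' : chain n Z X),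
    [/\ short_exact j q, exact_chain c' & c = splice_l j q c'].
Proof.
case: c => I [j c] [/= /exact0_mono hj hc].
pose Z := coker j; have hs := short_exact_coker hj.
have [c' [hc' ec]] : exists c' : chain n Z X, exact_chain c' /\ c = precomp (cokermap j) c'.
  case: n c hc => [c [h1 h2]|n [E [a d]] [/= h1 h2]].
    have e := exact_comp0 h1; exists (coker_desc e); split; last by rewrite /= coker_descE.
    have hm := cokernel_desc_mono h1 (cokermapP j) (coker_descE e).
    split; first exact: mono_exact0.
    by apply/(exact_comp_epi _ _ (@cokermap_epi _ _ _ j)); rewrite coker_descE.
  have e := exact_comp0 h1; exists (existT _ E (coker_desc e, d)).
  split; last by rewrite /= coker_descE.
  have hm := cokernel_desc_mono h1 (cokermapP j) (coker_descE e).
  split; first exact: mono_exact0.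
  by apply/(exact_from_epi _ _ (@cokermap_epi _ _ _ j)); rewrite coker_descE.
by exists I, Z, j, (cokermap j), c'; split; rewrite // ec.
Qed.

Lemma exact_splice_r n W Y L E X (f : Hom W Y) (k : Hom L E) (p : Hom E X)
    (c : chain n Y L) :
  short_exact k p -> exact_from f c -> exact_from f (splice_r k p c).
Proof.
move=> hs; have /short_exactP [hk hkp hp] := hs.
elim: n W Y f c => [|n IHn] W Y f c [h1 h2]; last by split=> //; apply: IHn.
split; first exact/exact_comp_mono.
split; last exact: epi_exact0.
exact/(exact_comp_epi _ _ (exact0_epi h2)).
Qed.

Lemma unsplice_r n W Y X (f : Hom W Y) (c : chain n.+1 Y X) : exact_from f c ->
  exists L E (k : Hom L E) (p : Hom E X) (c' : chain n Y L),
    [/\ short_exact k p, exact_from f c' & c = splice_r k p c'].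
Proof.
elim: n W Y f c => [|n IHn] W Y f [E [a d]] [/= h1 h2].
  have [h3 /exact0_epi h4] := h2; have e := exact_comp0 h3.
  exists (ker d), E, (kermap d), d, (ker_lift e); split; first exact: short_exact_ker.
    split; first by apply/(exact_comp_mono _ _ (@kermap_mono _ _ _ d)); rewrite ker_liftE.
    exact: epi_exact0 (kernel_lift_epi h3 (kermapP d) (ker_liftE e)).
  by rewrite /= ker_liftE.
have [L [E' [k [p [c' [hs hc' ->]]]]]] := IHn _ _ _ _ h2.
by exists L, E', k, p, (existT _ E (a, c')).
Qed.

Lemma chain_morph_idm n X Z (c : chain n X Z) : chain_morph (idm X) c c.
Proof.
elim: n X c => [|n IHn] X c /=; first by rewrite compm1.
by exists (idm _); rewrite comp1m compm1.
Qed.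

Lemma precomp_morph n W W' X X' Z (q : Hom W X) (q' : Hom W' X') (v : Hom W W')
    (w : Hom X X') (c : chain n X Z) (c' : chain n X' Z) :
  chain_morph w c c' -> w ∘ q = q' ∘ v -> chain_morph v (precomp q c) (precomp q' c').
Proof.
case: n c c' => [|n] c c' /= => [-> e|[x [ex hx]] e]; first by rewrite -!compmA e.
by exists x; rewrite compmA ex -!compmA e.
Qed.

Lemma splice_r_morph n Y Y' L E X (k : Hom L E) (p : Hom E X) (u : Hom Y Y')
    (c : chain n Y L) (c' : chain n Y' L) :
  chain_morph u c c' -> chain_morph u (splice_r k p c) (splice_r k p c').
Proof.
elim: n Y Y' u c c' => [|n IHn] Y Y' u c c' /=.
  by move=> ->; exists (idm _); rewrite comp1m compm1 compmA.
by case=> v [ev hv]; exists v; split=> //; apply: IHn.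
Qed.

(** Pushing an exact sequence out along a morphism from its left end affects
    the first inner term alone: W -> E and Z -> Q have the same cokernel, so
    that the rest of the sequence can be kept. *)
Lemma push_chain n W X Z (c : chain n.+1 W X) (w : Hom W Z) : exact_chain c ->
  exists c' : chain n.+1 Z X, exact_chain c' /\ chain_morph w c c'.
Proof.
case: c => E [a d] [/= /exact0_mono ha hd].
have [Q [i1 [i2 [hi1 ew hQ hun]]]] := pushout_mono w ha.
case: (bipP Z E) => _ e2 _ _ _.
have hp : epi (bpr2 Z E).
  by apply: (@epi_of_comp _ _ _ _ _ (bin2 Z E)); rewrite e2; apply: epi_idm.
have key V (g : Hom E V) : exact a g -> exists g' : Hom Q V,
    [/\ g' ∘ i2 = g, exact i1 g' &
        g' ∘ (i1 ∘ bpr1 Z E + i2 ∘ bpr2 Z E) = g ∘ bpr2 Z E].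
  move=> hg; have [|g' [eg1 eg2]] := hun V 0 g.
    by rewrite (exact_comp0 hg) comp0m.
  have eg3 : g' ∘ (i1 ∘ bpr1 Z E + i2 ∘ bpr2 Z E) = g ∘ bpr2 Z E.
    by rewrite compDr !compmA eg1 eg2 comp0m add0r.
  exists g'; split=> //; apply/exactP; split=> // S x ex.
  have [S1 [q [l [hq el]]]] := pullback_epi x hQ.
  have gl : g ∘ (bpr2 Z E ∘ l) = 0 by rewrite compmA -eg3 -compmA el compmA ex comp0m.
  have [S2 [q' [t [hq' et]]]] := exact_lift hg gl.
  exists S2, (q ∘ q'), (bpr1 Z E ∘ l ∘ q' + w ∘ t); split; first exact: epi_comp.
  rewrite (compmA x) -el compDr (compmA i1 w) ew -(compmA i2 a) et !compDl.
  by rewrite !compmA.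
case: n d hd => [d [h1 h2]|n [V [g d]] [/= h1 h2]].
  have [g' [eg2 hg eg3]] := key _ _ h1; exists (existT _ Q (i1, g')); split.
    split; first exact: mono_exact0.
    split=> //; apply/(exact_comp_epi _ _ hQ); rewrite eg3.
    exact/(exact_comp_epi _ _ hp).
  by exists i2.
have [g' [eg2 hg eg3]] := key _ _ h1.
exists (existT _ Q (i1, existT _ V (g', d))); split.
  split; first exact: mono_exact0.
  split=> //=; apply/(exact_from_epi _ _ hQ); rewrite eg3.
  exact/(exact_from_epi _ _ hp).
exists i2; split=> //=; exists (idm V); split; first by rewrite comp1m.
exact: chain_morph_idm.
Qed.

(** Pulling an exact sequence back along a morphism w to its right end.  As
    chain_morph fixes the right end, the comparison over w is expressed after
    prolonging both sequences to the right, which is how it is used. *)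
Lemma pull_chain n W Y L K (f : Hom W Y) (c : chain n.+1 Y L) (w : Hom K L) :
  exact_from f c -> exists c' : chain n.+1 Y K, exact_from f c' /\
    forall E P X (l : Hom L E) (q : Hom E X) (k : Hom K P) (p : Hom P X) (s : Hom P E),
      s ∘ k = l ∘ w -> q ∘ s = p ->
      chain_morph (idm Y) (splice_r k p c') (splice_r l q c).
Proof.
elim: n W Y f c => [|n IHn] W Y f [E [a b]] [/= h1 h2]; last first.
  have [d [hd hm]] := IHn _ _ _ _ h2.
  exists (existT _ E (a, d)); split=> // E' P X l q k p s e1 e2.
  by exists (idm E); rewrite comp1m compm1; split=> //; apply: hm e1 e2.
have [h3 h4] := h2; have hb := exact0_epi h4.
have [Q [p1 [p2 [hp1 ew hQ hun]]]] := pullback_epi_square w hb.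
have jm V (u v : Hom V Q) : p1 ∘ u = p1 ∘ v -> p2 ∘ u = p2 ∘ v -> u = v.
  by move=> x y; apply: hQ; rewrite !compDl -!compmA x y.
have [|a' [ea1 ea2]] := hun Y 0 a; first by rewrite compm0 (exact_comp0 h3).
exists (existT _ Q (a', p1)); split.
  split.
    apply/exactP; split=> [|V u eu].
      by apply: jm; rewrite compmA ?ea1 ?ea2 compm0 ?comp0m ?(exact_comp0 h1).
    by apply: (exact_lift h1); rewrite -ea2 -compmA eu compm0.
  split=> /=; last exact: epi_exact0.
  apply/exactP; split=> // V u eu.
  have [|V1 [q [l [hq el]]]] := exact_lift h3 (h := p2 ∘ u).
    by rewrite compmA -ew -compmA eu compm0.
  exists V1, q, l; split=> //; apply: jm; rewrite !compmA ?ea1 ?ea2 ?eu //.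
  by rewrite !comp0m.
move=> E' P X l q k p s e1 e2; exists p2; split; first by rewrite compm1.
by exists s; split; rewrite //= compmA e1 -!compmA ew.
Qed.

Lemma chain_inner_splice_l P n Y I Z X (j : Hom Y I) (q : Hom I Z) (c : chain n Z X) :
  chain_inner P (splice_l j q c) <-> P I /\ chain_inner P c.
Proof. by case: n c. Qed.

Lemma chain_inner_splice_r P n Y L E X (k : Hom L E) (p : Hom E X) (c : chain n Y L) :
  chain_inner P (splice_r k p c) <-> chain_inner P c /\ P E.
Proof.
elim: n Y c => [|n IHn] Y c; first by split; case.
by have [h1 h2] := IHn _ (projT2 c).2; split=> [[? /h1 []]|[[? ?] ?]]; split=> //; apply: h2.
Qed.

End Splicing.

(** * Finite resolutions *)

Section Resolving.
Variables (C : abelian) (P : C -> Prop).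
Implicit Types D K X : C.

Lemma wedge_base m X : P X -> wedge P m X.
Proof.
move=> hX; exists 0%N; split=> //; exists X, (idm X); split=> //.
exact: exact_chain_idm.
Qed.

Lemma vee_base m X : P X -> vee P m X.
Proof.
move=> hX; exists 0%N; split=> //; exists X, (idm X); split=> //.
exact: exact_chain_idm.
Qed.

Lemma wedge_step m K D X (f : Hom K D) (g : Hom D X) :
  short_exact f g -> P D -> wedge P m K -> wedge P m.+1 X.
Proof.
move=> hs hD [k [hk [Ck [c [hc hCk hin]]]]]; exists k.+1; split=> //.
exists Ck, (splice_r f g c); split=> //; first exact: exact_splice_r.
by apply/chain_inner_splice_r.
Qed.

Lemma vee_step m K D X (f : Hom X D) (g : Hom D K) :
  short_exact f g -> P D -> vee P m K -> vee P m.+1 X.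
Proof.
move=> hs hD [k [hk [Ck [c [hc hCk hin]]]]]; exists k.+1; split=> //.
exists Ck, (splice_l f g c); split=> //; first exact: exact_splice_l.
by apply/chain_inner_splice_l.
Qed.

Lemma wedge_inv m X : wedge P m X -> (exists D, P D /\ isomorphic D X) \/
  exists m' K D (f : Hom K D) (g : Hom D X),
    [/\ m = m'.+1, short_exact f g, P D & wedge P m' K].
Proof.
case=> -[|k] [hk [Ck [c [hc hCk hin]]]].
  by left; exists Ck; split=> //; apply: exact_chain0 hc.
right; have [K [D [f [g [c' [hs hc' ec]]]]]] := unsplice_r hc.
move: hin; rewrite ec => /chain_inner_splice_r [hin hD].
case: m hk => // m hk; exists m, K, D, f, g; split=> //.
by exists k; split=> //; exists Ck, c'.
Qed.

Lemma vee_inv m X : vee P m X -> (exists D, P D /\ isomorphic D X) \/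
  exists m' K D (f : Hom X D) (g : Hom D K),
    [/\ m = m'.+1, short_exact f g, P D & vee P m' K].
Proof.
case=> -[|k] [hk [Ck [c [hc hCk hin]]]].
  by left; exists Ck; split=> //; apply/isomorphic_sym/(exact_chain0 hc).
right; have [D [K [f [g [c' [hs hc' ec]]]]]] := unsplice_l hc.
move: hin; rewrite ec => /chain_inner_splice_l [hD hin].
case: m hk => // m hk; exists m, K, D, f, g; split=> //.
by exists k; split=> //; exists Ck, c'.
Qed.

End Resolving.

(** * Yoneda extensions under exact functors *)

Section YonedaSplice.
Variable C : abelian.

Lemma yoneda_step n (X Y : C) (c c' : chain n Y X) (h : exact_chain c)
    (h' : exact_chain c') : chain_morph (idm Y) c c' ->
  yoneda_equiv (exist _ c h : extension n X Y) (exist _ c' h').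
Proof. by move=> hm; apply: rst_step. Qed.

Lemma yoneda_equiv_map m n (X Y X' Y' : C)
    (F : extension m X Y -> extension n X' Y') :
  (forall e e', extension_morph e e' -> extension_morph (F e) (F e')) ->
  forall e e', yoneda_equiv e e' -> yoneda_equiv (F e) (F e').
Proof.
move=> hF e e'; elim=> [a b /hF|a|a b _ IH|a b c _ IH1 _ IH2].
- exact: rst_step.
- exact: rst_refl.
- exact: rst_sym.
- exact: rst_trans IH1 IH2.
Qed.

Definition ext_splice_l n (X Y I Z : C) (j : Hom Y I) (q : Hom I Z)
    (h : short_exact j q) (e : extension n X Z) : extension n.+1 X Y :=
  exist _ (splice_l j q (proj1_sig e)) (exact_splice_l h (proj2_sig e)).

Definition ext_splice_r n (X Y K D : C) (k : Hom K D) (p : Hom D X)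
    (h : short_exact k p) (e : extension n K Y) : extension n.+1 X Y :=
  exist _ (splice_r k p (proj1_sig e)) (exact_splice_r h (proj2_sig e)).

Lemma yoneda_splice_l n (X Y I Z : C) (j : Hom Y I) (q : Hom I Z)
    (h : short_exact j q) (e e' : extension n X Z) :
  yoneda_equiv e e' -> yoneda_equiv (ext_splice_l h e) (ext_splice_l h e').
Proof.
apply: yoneda_equiv_map => a b hab; exists (idm I).
by rewrite comp1m compm1; split=> //; apply: precomp_morph hab _; rewrite comp1m compm1.
Qed.

Lemma yoneda_splice_r n (X Y K D : C) (k : Hom K D) (p : Hom D X)
    (h : short_exact k p) (e e' : extension n K Y) :
  yoneda_equiv e e' -> yoneda_equiv (ext_splice_r h e) (ext_splice_r h e').
Proof. by apply: yoneda_equiv_map => a b; apply: splice_r_morph. Qed.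

End YonedaSplice.

Lemma eq_exist (T : Type) (P : T -> Prop) (a b : T) (ha : P a) (hb : P b) :
  a = b -> exist P a ha = exist P b hb.
Proof. by move=> e; subst b; rewrite (Prop_irrelevance ha hb). Qed.

Section ExactFunctor.
Variables (C D : abelian) (F : functor C D).
Hypothesis F_exact : forall (X Y Z : C) (f : Hom X Y) (g : Hom Y Z),
  exact f g -> exact (fmap F f) (fmap F g).

Fixpoint chain_map n : forall X Z : C, chain n X Z -> chain n (F X) (F Z) :=
  match n with
  | 0 => fun X Z c => fmap F (c : Hom X Z)
  | m.+1 => fun X Z c =>
      existT _ (F (projT1 c)) (fmap F (projT2 c).1, chain_map (projT2 c).2)
  end.

Lemma functor_zero (X : C) : is_zero X -> is_zero (F X).
Proof. by move=> h; apply: is_zeroP; rewrite -fmap1 (zero_homl (idm X) h) fmap0. Qed.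

Lemma functor_mono (X Y : C) (f : Hom X Y) : mono f -> mono (fmap F f).
Proof.
move=> /mono_exact0/F_exact/exact_lift h; apply: mono0P => W u /h [V [p [l [hp el]]]].
by apply: (epi_eq0 hp); rewrite -el fmap0 comp0m.
Qed.

Lemma functor_epi (X Y : C) (f : Hom X Y) : epi f -> epi (fmap F f).
Proof.
move=> /epi_exact0/F_exact/exact_lift h; apply/epiP => W u; apply: h.
by rewrite fmap0 comp0m.
Qed.

Lemma functor_short_exact (X Y Z : C) (f : Hom X Y) (g : Hom Y Z) :
  short_exact f g -> short_exact (fmap F f) (fmap F g).
Proof.
move=> /short_exactP [a b c]; apply/short_exactP; split.
- exact: functor_mono.
- exact: F_exact.
- exact: functor_epi.
Qed.

Lemma exact_from_map n (W X Z : C) (f : Hom W X) (c : chain n X Z) :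
  exact_from f c -> exact_from (fmap F f) (chain_map c).
Proof.
elim: n W X f c => [|n IHn] W X f c [h1 h2]; split.
- exact: F_exact.
- by apply/epi_exact0/functor_epi/exact0_epi.
- exact: F_exact.
- exact: IHn.
Qed.

Lemma exact_chain_map n (X Z : C) (c : chain n X Z) :
  exact_chain c -> exact_chain (chain_map c).
Proof. by move/exact_from_map; rewrite fmap0; apply: exact_from_zero. Qed.

Lemma chain_morph_map n (X X' Z : C) (u : Hom X X') (c : chain n X Z)
    (c' : chain n X' Z) :
  chain_morph u c c' -> chain_morph (fmap F u) (chain_map c) (chain_map c').
Proof.
elim: n X X' u c c' => [|n IHn] X X' u c c' /=; first by move=> ->; rewrite fmapM.
case=> v [ev hv]; exists (fmap F v); rewrite -!fmapM ev; split=> //; exact: IHn.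
Qed.

Lemma chain_map_splice_l n (Y I Z X : C) (j : Hom Y I) (q : Hom I Z) (c : chain n Z X) :
  chain_map (splice_l j q c) = splice_l (fmap F j) (fmap F q) (chain_map c).
Proof. by case: n c => [|n] c; rewrite /splice_l /= fmapM. Qed.

Lemma chain_map_splice_r n (L E X : C) (k : Hom L E) (p : Hom E X) Y (c : chain n Y L) :
  chain_map (splice_r k p c) = splice_r (fmap F k) (fmap F p) (chain_map c).
Proof.
elim: n Y c => [|n IHn] Y c /=; first by rewrite fmapM.
by have /= -> := IHn _ (projT2 c).2.
Qed.

Lemma chain_inner_map (P : C -> Prop) (Q : D -> Prop) n (X Z : C) (c : chain n X Z) :
  (forall X, P X -> Q (F X)) -> chain_inner P c -> chain_inner Q (chain_map c).
Proof. by move=> h; elim: n X c => //= n IHn X c [/h ? /IHn]. Qed.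

Lemma wedge_map (P : C -> Prop) (Q : D -> Prop) m X :
  (forall X, P X -> Q (F X)) -> wedge P m X -> wedge Q m (F X).
Proof.
move=> h [k [hk [K [c [hc hK hin]]]]]; exists k; split=> //.
exists (F K), (chain_map c); split; last exact: chain_inner_map hin.
- exact: exact_chain_map.
- exact: h.
Qed.

Lemma vee_map (P : C -> Prop) (Q : D -> Prop) m X :
  (forall X, P X -> Q (F X)) -> vee P m X -> vee Q m (F X).
Proof.
move=> h [k [hk [K [c [hc hK hin]]]]]; exists k; split=> //.
exists (F K), (chain_map c); split; last exact: chain_inner_map hin.
- exact: exact_chain_map.
- exact: h.
Qed.

Definition ext_map n (X Y : C) (e : extension n X Y) : extension n (F X) (F Y) :=
  exist _ (chain_map (proj1_sig e)) (exact_chain_map (proj2_sig e)).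

Lemma yoneda_equiv_ext_map n (X Y : C) (e e' : extension n X Y) :
  yoneda_equiv e e' -> yoneda_equiv (ext_map e) (ext_map e').
Proof.
elim=> [a b|a|a b _ IH|a b c _ IH1 _ IH2].
- by move/chain_morph_map; rewrite fmap1 => ?; apply: rst_step.
- exact: rst_refl.
- exact: rst_sym.
- exact: rst_trans IH1 IH2.
Qed.

Lemma ext_map_splice_l n (X Y I Z : C) (j : Hom Y I) (q : Hom I Z)
    (h : short_exact j q) (e : extension n X Z) :
  ext_map (ext_splice_l h e) = ext_splice_l (functor_short_exact h) (ext_map e).
Proof. by apply: eq_exist; apply: chain_map_splice_l. Qed.

Lemma ext_map_splice_r n (X Y K E : C) (k : Hom K E) (p : Hom E X)
    (h : short_exact k p) (e : extension n K Y) :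
  ext_map (ext_splice_r h e) = ext_splice_r (functor_short_exact h) (ext_map e).
Proof. by apply: eq_exist; apply: chain_map_splice_r. Qed.

(** Vanishing of Ext is inherited along an exact functor as soon as every
    extension downstairs is Yoneda equivalent to one coming from upstairs. *)
Lemma ext_zero_map n (X Y : C) : ext_zero n X Y ->
  (forall e : extension n (F X) (F Y),
    exists e0 : extension n X Y, yoneda_equiv (ext_map e0) e) ->
  ext_zero n (F X) (F Y).
Proof.
move=> h0 hl e e'; have [a ha] := hl e; have [b hb] := hl e'.
apply: rst_trans (rst_sym _ _ _ _ ha) (rst_trans _ _ _ _ _ _ hb).
exact/yoneda_equiv_ext_map/h0.
Qed.

End ExactFunctor.

(** * Kernels and cokernels of morphisms of sequences *)

Section Kernels.
Variable C : abelian.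

Lemma mono_ker_zero (X Y : C) (f : Hom X Y) : mono f -> is_zero (ker f).
Proof.
move=> hf; apply: is_zeroP; apply: (mono_eq0 (@kermap_mono _ _ _ f)).
by rewrite compm1; apply: (mono_eq0 hf); apply: kermap0.
Qed.

Lemma ker0_isomorphic (X Y : C) (f : Hom X Y) : f = 0 -> isomorphic X (ker f).
Proof.
move=> e; have e0 : f ∘ idm X = 0 by rewrite e comp0m.
exists (ker_lift e0), (kermap f); split; first exact: ker_liftE.
by apply: (@kermap_mono _ _ _ f); rewrite compmA ker_liftE comp1m compm1.
Qed.

Lemma ker_isomorphic (X X' Y Y' : C) (f : Hom X Y) (f' : Hom X' Y')
    (a : Hom X X') (a' : Hom X' X) (b : Hom Y Y') (b' : Hom Y' Y) :
  a' ∘ a = idm X -> a ∘ a' = idm X' -> f' ∘ a = b ∘ f -> f ∘ a' = b' ∘ f' ->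
  isomorphic (ker f) (ker f').
Proof.
move=> e1 e2 ef ef'.
have u0 : f' ∘ (a ∘ kermap f) = 0 by rewrite compmA ef -compmA kermap0 compm0.
have v0 : f ∘ (a' ∘ kermap f') = 0 by rewrite compmA ef' -compmA kermap0 compm0.
exists (ker_lift u0), (ker_lift v0); split; apply: (@kermap_mono C);
  by rewrite compm1 compmA ker_liftE -compmA ker_liftE compmA ?e1 ?e2 comp1m.
Qed.

(** The piece of the snake lemma before the connecting morphism, which has
    the zero object coker v as its target. *)
Lemma ker_short_exact (V D W V' D' W' : C) (f : Hom V D) (g : Hom D W)
    (f' : Hom V' D') (g' : Hom D' W') (v : Hom V V') (d : Hom D D') (w : Hom W W') :
  short_exact f g -> mono f' -> exact f' g' -> f' ∘ v = d ∘ f -> g' ∘ d = w ∘ g ->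
  epi v -> exists (k : Hom (ker v) (ker d)) (l : Hom (ker d) (ker w)), short_exact k l.
Proof.
move=> /short_exactP [hf hfg hg] hf' hfg' ef eg hv.
have k0 : d ∘ (f ∘ kermap v) = 0 by rewrite compmA -ef -compmA kermap0 compm0.
have l0 : w ∘ (g ∘ kermap d) = 0 by rewrite compmA -eg -compmA kermap0 compm0.
have kv := @kermap_mono _ _ _ v; have kd := @kermap_mono _ _ _ d.
have kw := @kermap_mono _ _ _ w.
exists (ker_lift k0), (ker_lift l0); apply/short_exactP; split.
- apply: (@mono_of_comp _ _ _ _ (kermap d)); rewrite ker_liftE; exact: mono_comp.
- apply/exactP; split=> [|U u eu].
    apply: (mono_eq0 kw); rewrite compmA ker_liftE -compmA ker_liftE compmA.
    by rewrite (exact_comp0 hfg) comp0m.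
  have [|x ex] := exact_factor hfg hf (h := kermap d ∘ u).
    by rewrite compmA -(ker_liftE l0) -compmA eu compm0.
  have vx : v ∘ x = 0.
    by apply: (mono_eq0 hf'); rewrite compmA ef -compmA ex compmA kermap0 comp0m.
  exists U, (idm U), (ker_lift vx); split; first exact: epi_idm.
  by apply: kd; rewrite compmA ker_liftE -compmA ker_liftE ex compm1.
- apply/epiP => U u.
  have [U1 [p [x [hp ex]]]] := pullback_epi (kermap w ∘ u) hg.
  have dx : g' ∘ (d ∘ x) = 0.
    by rewrite compmA eg -compmA ex !compmA kermap0 !comp0m.
  have [y ey] := exact_factor hfg' hf' dx.
  have [U2 [q [z [hq ez]]]] := pullback_epi y hv.
  have d0 : d ∘ (x ∘ q - f ∘ z) = 0.
    by rewrite compDr compNr !compmA -ef -!compmA ez (compmA f') ey compmA subrr.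
  exists U2, (p ∘ q), (ker_lift d0); split; first exact: epi_comp.
  apply: kw; rewrite compmA ker_liftE -compmA ker_liftE compDr compNr !compmA.
  by rewrite (exact_comp0 hfg) comp0m subr0 ex.
Qed.

End Kernels.

Section Cokernels.
Variable C : abelian.

Lemma epi_coker_zero (X Y : C) (f : Hom X Y) : epi f -> is_zero (coker f).
Proof.
move=> hf; have h := @mono_ker_zero (op C) Y X f hf.
by move=> Z; split=> u v; [apply: (proj2 (h Z)) | apply: (proj1 (h Z))].
Qed.

Lemma coker0_isomorphic (X Y : C) (f : Hom X Y) : f = 0 -> isomorphic Y (coker f).
Proof.
by move=> e; have [u [v [e1 e2]]] := @ker0_isomorphic (op C) Y X f e; exists v, u.
Qed.

Lemma coker_isomorphic (X X' Y Y' : C) (f : Hom X Y) (f' : Hom X' Y')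
    (a : Hom X X') (a' : Hom X' X) (b : Hom Y Y') (b' : Hom Y' Y) :
  b' ∘ b = idm Y -> b ∘ b' = idm Y' -> f' ∘ a = b ∘ f -> f ∘ a' = b' ∘ f' ->
  isomorphic (coker f) (coker f').
Proof.
move=> e1 e2 ef ef'.
have [u [v [h1 h2]]] := @ker_isomorphic (op C) Y' Y X' X f' f b b' a a'
  e2 e1 (esym ef) (esym ef').
by exists u, v.
Qed.

Lemma coker_short_exact (V D W V' D' W' : C) (f : Hom V D) (g : Hom D W)
    (f' : Hom V' D') (g' : Hom D' W') (v : Hom V V') (d : Hom D D') (w : Hom W W') :
  exact f g -> epi g -> short_exact f' g' -> f' ∘ v = d ∘ f -> g' ∘ d = w ∘ g ->
  mono w ->
  exists (k : Hom (coker v) (coker d)) (l : Hom (coker d) (coker w)), short_exact k l.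
Proof.
move=> hfg hg /short_exact_op hs ef eg hw.
have [k [l hkl]] := @ker_short_exact (op C) W' D' V' W D V g' f' g f w d v
  hs hg (exact_op hfg) (esym eg) (esym ef) hw.
by exists l, k; apply/short_exact_op.
Qed.

End Cokernels.

(** * The comma category of a left exact functor *)

Section GCommaExact.
Variables (A B : abelian) (G : leftExactFunctor A B).
Let P := Gcomma G.

Lemma GexactP (X Y Z : P) (f : Hom X Y) (g : Hom Y Z) :
  exact f g <-> exact (ga f) (ga g) /\ exact (gb f) (gb g).
Proof.
split=> [[e he]|[ha hb]].
  have [pa pb] := Gepi he; have ek := ker_liftE e.
  split; [apply: (exact_ker (kermapP (ga g)) pa) | apply: (exact_ker (kermapP (gb g)) pb)].
    exact: (congr1 (@ga _ _ _ _ _) ek).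
  exact: (congr1 (@gb _ _ _ _ _) ek).
have e : g ∘ f = 0 by apply: Gmor_eq; apply: exact_comp0.
exists e; have ek := ker_liftE e.
case: ha hb => [ea ha] [eb hb].
have pa : epi (ga (ker_lift e)).
  suff -> : ga (ker_lift e) = ker_lift ea by [].
  apply: (@kermap_mono _ _ _ (ga g)); rewrite ker_liftE.
  exact: (congr1 (@ga _ _ _ _ _) ek).
have pb : epi (gb (ker_lift e)).
  suff -> : gb (ker_lift e) = ker_lift eb by [].
  apply: (@kermap_mono _ _ _ (gb g)); rewrite ker_liftE.
  exact: (congr1 (@gb _ _ _ _ _) ek).
move=> W u v euv; apply: Gmor_eq.
  by apply: pa; exact: (congr1 (@ga _ _ _ _ _) euv).
by apply: pb; exact: (congr1 (@gb _ _ _ _ _) euv).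
Qed.

Lemma Gshort_exactP (X Y Z : P) (f : Hom X Y) (g : Hom Y Z) :
  short_exact (ga f) (ga g) -> short_exact (gb f) (gb g) -> short_exact f g.
Proof. by move=> [? ? ?] [? ? ?]; split; apply/GexactP. Qed.

Definition GprA : functor P A :=
  @Functor P A (@gA A B G) (fun X Y f => ga f)
    (fun X => erefl) (fun X Y Z g f => erefl) (fun X Y f g => erefl).

Definition GprB : functor P B :=
  @Functor P B (@gB A B G) (fun X Y f => gb f)
    (fun X => erefl) (fun X Y Z g f => erefl) (fun X Y f g => erefl).

Lemma GprA_exact (X Y Z : P) (f : Hom X Y) (g : Hom Y Z) :
  exact f g -> exact (fmap GprA f) (fmap GprA g).
Proof. by case/GexactP. Qed.

Lemma GprB_exact (X Y Z : P) (f : Hom X Y) (g : Hom Y Z) :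
  exact f g -> exact (fmap GprB f) (fmap GprB g).
Proof. by case/GexactP. Qed.

Lemma Giso (X Y : P) (a : Hom (gA X) (gA Y)) (a' : Hom (gA Y) (gA X))
    (b : Hom (gB X) (gB Y)) (b' : Hom (gB Y) (gB X)) :
  a' ∘ a = idm _ -> a ∘ a' = idm _ -> b' ∘ b = idm _ -> b ∘ b' = idm _ ->
  gphi Y ∘ b = fmap G a ∘ gphi X -> isomorphic X Y.
Proof.
move=> ea ea' eb eb' c.
have c' : gphi X ∘ b' = fmap G a' ∘ gphi Y.
  rewrite -[LHS]comp1m -fmap1 -ea fmapM -(compmA (fmap G a')) (compmA (fmap G a)) -c.
  by rewrite -(compmA _ b) eb' compm1.
by exists (GMor c), (GMor c'); split; apply: Gmor_eq.
Qed.

(** Test objects of the comma category.  (X, 0) and (0, Y) lie in the class of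
    pairs as soon as X, resp. Y, lies in the given class; (M, G M) and (0, N)
    lie in the class D as soon as M, resp. N, lies in the given class, because
    their structure maps are epi with kernels 0 and N. *)
Definition Gleft (X : A) : P := @GOb A B G X zob 0.

Definition Gunit (X : A) : P := @GOb A B G X (G X) (idm (G X)).

Definition Gright_ob (Y : B) : P := @GOb A B G zob Y 0.

Fact Gright_comm (X Y : B) (f : Hom X Y) :
  gphi (Gright_ob Y) ∘ f = fmap G (0 : Hom zob zob) ∘ gphi (Gright_ob X).
Proof. by rewrite comp0m compm0. Qed.

Definition Gright : functor B P.
Proof.
refine (@Functor B P Gright_ob
  (fun X Y f => @GMor A B G (Gright_ob X) (Gright_ob Y) 0 f (Gright_comm f)) _ _ _).
- by move=> X; apply: Gmor_eq => //; apply: (proj1 (@zobP A _)).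
- by move=> X Y Z g f; apply: Gmor_eq => //=; rewrite comp0m.
- by move=> X Y f g; apply: Gmor_eq => //=; rewrite addr0.
Defined.

Lemma Gright_exact (X Y Z : B) (f : Hom X Y) (g : Hom Y Z) :
  exact f g -> exact (fmap Gright f) (fmap Gright g).
Proof. by move=> h; apply/GexactP; split=> //; apply/exact_zero/zobP. Qed.

Fact Gunit_comm (X Y : A) (f : Hom X Y) :
  gphi (Gunit Y) ∘ fmap G f = fmap G f ∘ gphi (Gunit X).
Proof. by rewrite /= comp1m compm1. Qed.

Definition Gunit_map (X Y : A) (f : Hom X Y) : Hom (Gunit X) (Gunit Y) :=
  @GMor A B G (Gunit X) (Gunit Y) f (fmap G f) (Gunit_comm f).

Lemma Gunit_short_exact (X Y Z : A) (f : Hom X Y) (g : Hom Y Z) :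
  short_exact f g -> epi (fmap G g) -> short_exact (Gunit_map f) (Gunit_map g).
Proof.
move=> hs hg; apply: Gshort_exactP => //.
have /short_exactP [hf hfg _] := hs; apply/short_exactP; split=> //.
- exact: lfun_mono.
- exact: lfun_exact.
Qed.

(** An extension of X by M lifts along the first projection to one of (X, 0)
    by (M, G M): it is Yoneda equivalent to one all of whose terms but the last
    are injective, and by acyclicity G keeps that part exact. *)
Lemma Gunit_lift (hI : enough_injectives A) k (X M : A) (e : extension k.+1 X M) :
  acyclic G k M -> exists e0 : extension k.+1 (Gleft X) (Gunit M),
    yoneda_equiv (ext_map GprA_exact e0 : extension k.+1 X M) e.
Proof.
elim: k X M e => [|k IHk] X M [c hc] hM.
  case: c hc => E [a b] hc.
  have [h0 [hab hb]] := hc; rewrite /= in h0 hab hb.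
  pose E' : P := @GOb A B G E (G M) (fmap G a).
  have ca : gphi E' ∘ idm (G M) = fmap G a ∘ gphi (Gunit M) by [].
  have cb : gphi (Gleft X) ∘ 0 = fmap G b ∘ gphi E'.
    by rewrite compm0 -fmapM (exact_comp0 hab) fmap0.
  pose a' : Hom (Gunit M) E' := @GMor A B G (Gunit M) E' a (idm (G M)) ca.
  pose b' : Hom E' (Gleft X) := @GMor A B G E' (Gleft X) b 0 cb.
  have hs : exact_chain (existT _ E' (a', b') : @chain P 1 (Gunit M) (Gleft X)).
    split; first by apply/GexactP; split=> //; apply/mono_exact0/mono_idm.
    split; apply/GexactP; split=> //; last exact/exact_zero/zobP.
    exact/epi_exact0/epi_idm.
  exists (exist _ _ hs); apply: yoneda_step; exact: chain_morph_idm.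
have [E [W [j [q [d [hs hd ec]]]]]] := unsplice_l hc.
have [I [i [hIi hi]]] := injective_embedding hI M.
have [eG hZ] := hM _ _ _ _ hIi hi.
have /short_exactP [hj hjq hq] := hs; have /short_exactP [_ hip _] := hi.
have [v ev] := hIi _ _ j i hj.
have [|w ew] := exact_cofactor hjq hq (h := cokermap i ∘ v).
  by rewrite -compmA ev (exact_comp0 hip).
have [d' [hd' hm]] := push_chain w hd.
have [e0 he0] := IHk _ _ (exist _ d' hd') hZ.
exists (ext_splice_l (Gunit_short_exact hi eG) e0).
rewrite ext_map_splice_l.
apply: rst_trans (yoneda_splice_l _ he0) (rst_sym _ _ _ _ _).
apply: yoneda_step; rewrite ec; exists v; rewrite ev compm1; split=> //.
exact: precomp_morph hm ew.
Qed.

(** The embedding by (0, Y) is exact, and the second projection retracts it: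
    extensions in B lift without any change. *)
Lemma Gright_lift k (Y N : B) (e : extension k Y N) :
  yoneda_equiv (ext_map GprB_exact (ext_map Gright_exact e) : extension k Y N) e.
Proof.
case: e => c hc; apply: yoneda_step => /=.
have h n (X Z : B) (d : chain n X Z) : chain_map GprB (chain_map Gright d) = d.
  by elim: n X d => // n IHn X [V [a d]] /=; have /= -> := IHn V d.
by rewrite h; apply: chain_morph_idm.
Qed.

Lemma Dclass_iso (M : A -> Prop) (N : B -> Prop) (X Y : P) :
  object_class M -> object_class N -> isomorphic X Y ->
  @Dclass A B G M N X -> @Dclass A B G M N Y.
Proof.
move=> [_ hM] [_ hN] [f [g [e1 e2]]] [mX eX nX].
have a1 : ga g ∘ ga f = idm _ := congr1 (@ga _ _ _ _ _) e1.
have a2 : ga f ∘ ga g = idm _ := congr1 (@ga _ _ _ _ _) e2.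
have b1 : gb g ∘ gb f = idm _ := congr1 (@gb _ _ _ _ _) e1.
have b2 : gb f ∘ gb g = idm _ := congr1 (@gb _ _ _ _ _) e2.
split.
- by apply: hM mX; exists (ga f), (ga g).
- apply: (@epi_of_comp _ _ _ _ _ (gb f)); rewrite gcomm; apply: epi_comp eX.
  apply: (@epi_of_comp _ _ _ _ _ (fmap G (ga g))); rewrite -fmapM a2 fmap1.
  exact: epi_idm.
- exact: hN (ker_isomorphic b1 b2 (gcomm f) (gcomm g)) nX.
Qed.

(** If W has a finite resolution by objects of the class D, its first
    component inherits enough acyclicity for G to be exact on the first
    components of the resolution.  Hence the structure map of W is again epi,
    and the kernels of the structure maps form a resolution of its kernel. *)
Lemma wedge_Dclass (hI : enough_injectives A) n (M : A -> Prop) (N : B -> Prop)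
    k (W : P) :
  object_class M -> object_class N -> (forall m, M m -> acyclic G n m) ->
  (k < n)%N -> wedge (@Dclass A B G M N) k W ->
  [/\ acyclic G (n - k) (gA W), epi (gphi W) & wedge N k (ker (gphi W))].
Proof.
move=> hM hN hac; elim: k W => [|k IHk] W hk.
  case/wedge_inv=> [[D [hD hDW]]|[m [? [? [? [? []]]]]]] //.
  have [mW eW nW] := Dclass_iso hM hN hDW hD.
  by split; [rewrite subn0; apply: hac | | apply: wedge_base].
case/wedge_inv=> [[D [hD hDW]]|[m [K [D [f [g [[<-] hs [mD eD nD] hK]]]]]]].
  have [mW eW nW] := Dclass_iso hM hN hDW hD.
  by split; [apply: acyclic_le (leq_subr _ _) (hac _ mW) | | apply: wedge_base].
have [aK eK nK] := IHk _ (ltnW hk) hK.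
have hsA := functor_short_exact GprA_exact hs.
have hsB := functor_short_exact GprB_exact hs.
have enk : (n - k = (n - k.+1).+1)%N by rewrite subnSK // ltnW.
rewrite enk in aK.
have aD := acyclic_le (leq_subr k.+1 n) (hac _ mD).
have aW := acyclic_quotient hI hsA aK aD.
have eGg : epi (fmap G (ga g)) := acyclic_epi hI aK hsA.
have /short_exactP [hf hfg _] := hsA.
split=> //.
  by apply: (@epi_of_comp _ _ _ _ _ (gb g)); rewrite gcomm; apply: epi_comp.
have [u [v huv]] := ker_short_exact hsB (lfun_mono hf) (lfun_exact G hf hfg)
  (esym (gcomm f)) (esym (gcomm g)) eK.
exact: wedge_step huv nD nK.
Qed.

End GCommaExact.

(** * Left cotorsion pairs *)

Section LeftCotorsion.
Variables (A B : abelian) (hI : enough_injectives A) (G : leftExactFunctor A B).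
Variables (X M : A -> Prop) (Y N : B -> Prop) (n : nat).
Hypotheses (hX : object_class X) (hM : object_class M)
  (hY : object_class Y) (hN : object_class N).
Hypothesis hn : (1 <= n)%N.
Hypothesis hpair :
  hereditary_left_cotorsion_pair n (@Gpair_class A B G X Y) (@Dclass A B G M N).
Hypothesis hac : forall m, M m -> acyclic G n m.

Lemma left_ext_zero i (W V : Gcomma G) : (1 <= i <= n.+1)%N ->
  Gpair_class X Y W -> Dclass M N V -> ext_zero i W V.
Proof.
case: hpair => -[_ hext _] her /andP [i1]; rewrite leq_eqVlt => /orP [/eqP ->|].
  exact: her.
by rewrite ltnS => i2; apply: hext; rewrite i1.
Qed.

(** Ext descends along the first projection from the objects (X, 0) and
    (M, G M) by the lifting of extensions, and an approximation of (a, 0)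
    projects to one of a. *)
Lemma left_pairA : hereditary_left_cotorsion_pair n X M.
Proof.
have hext i x m : (1 <= i <= n.+1)%N -> X x -> M m -> ext_zero i x m.
  case: i => // i hi hx hm.
  have hz : ext_zero i.+1 (Gleft G x) (Gunit G m).
    apply: left_ext_zero => //; first by split=> //; case: hY.
    split=> //; first exact: epi_idm.
    case: hN => hN0; apply=> //; last exact: hN0.
    by apply: zero_isomorphic; [exact: zobP | apply/mono_ker_zero/mono_idm].
  have := ext_zero_map (F_exact := @GprA_exact A B G) hz; apply=> e.
  exact: (@Gunit_lift A B G hI i x m e (acyclic_le (hi : (i <= n)%N) (hac hm))).
case: hpair => -[hsum _ happ] _.
split; last by move=> x m; apply: hext; rewrite leqnn.
split.
- move=> x x' z hz [f [g [e1 e2]]].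
  suff : Gpair_class X Y (Gleft G x) by case.
  apply: (hsum _ (Gleft G x') (Gleft G z)); first by split=> //; case: hY.
  have [|b [b' [b1 b2]]] := @zero_isomorphic B zob (bip zob zob) (@zobP B).
    by apply: is_zero_bip; apply: zobP.
  apply: (@Giso A B G (Gleft G z) (bip (Gleft G x) (Gleft G x')) f g b b') => //.
  exact: (proj1 (@zobP B _)).
- by move=> i x m /andP [i1 i2]; apply: hext; rewrite i1 ltnW.
- move=> a; have [K [C [f [g [hs [hC _] hK]]]]] := happ (Gleft G a).
  exists (gA K), (gA C), (ga f), (ga g); split=> //.
    exact: (functor_short_exact (@GprA_exact A B G) hs).
  by apply: (wedge_map (@GprA_exact A B G) _ hK) => W [].
Qed.

(** Everything is tested on objects (0, Y).  In an approximation of (0, b) with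
    kernel K, the first component of K is isomorphic to that of the middle
    term, hence in the class X; the structure map of K exhibits its second
    component as an extension of an object resolved by assumption by a kernel
    resolved by wedge_Dclass. *)
Lemma left_pairB : extension_closed (wedge N n.-1) ->
  (forall x, X x -> wedge N n.-1 (G x)) -> hereditary_left_cotorsion_pair n Y N.
Proof.
move=> hclosed hGX.
have hext i y m : (1 <= i <= n.+1)%N -> Y y -> N m -> ext_zero i y m.
  move=> hi hy hm.
  have hz : ext_zero i (Gright G y) (Gright G m).
    apply: left_ext_zero => //; first by split=> //; case: hX.
    split; first by case: hM.
      by apply/zero_epi/functor_zero/zobP.
    by case: hN => _; apply; [apply: ker0_isomorphic | exact: hm].
  have := ext_zero_map (F_exact := @GprB_exact A B G) hz; apply=> e.
  by exists (ext_map (@Gright_exact A B G) e); apply: Gright_lift.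
case: hpair => -[hsum _ happ] _.
split; last by move=> y m; apply: hext; rewrite leqnn.
split.
- move=> y y' z hz [f [g [e1 e2]]].
  suff : Gpair_class X Y (Gright G y) by case.
  apply: (hsum _ (Gright G y') (Gright G z)); first by split=> //; case: hX.
  have [|a [a' [a1 a2]]] := @zero_isomorphic A zob (bip zob zob) (@zobP A).
    by apply: is_zero_bip; apply: zobP.
  apply: (@Giso A B G (Gright G z) (bip (Gright G y) (Gright G y')) a a' f g) => //.
  have h0 := functor_zero G (is_zero_bip (@zobP A) (@zobP A)).
  exact: (proj2 (h0 _)).
- by move=> i y m /andP [i1 i2]; apply: hext; rewrite i1 ltnW.
- move=> b; have [K [C [f [g [hs [hCX hCY] hK]]]]] := happ (Gright G b).
  have hsA := functor_short_exact (@GprA_exact A B G) hs.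
  have hsB := functor_short_exact (@GprB_exact A B G) hs.
  exists (gB K), (gB C), (gb f), (gb g); split=> //.
  have hn1 : (n.-1 < n)%N by rewrite prednK.
  have [_ eK nK] := wedge_Dclass hI hM hN hac hn1 hK.
  have XK : X (gA K).
    case: hX => _; apply; last exact: hCX.
    have /short_exactP [hf hfg _] := hsA.
    (* the first component of (0, b) vanishes, so ga f is an isomorphism *)
    have [|h [e1 e2]] := mono_epi_iso hf.
      apply: exact0_epi; rewrite -(zero_homr (ga g) (@zobP A)); exact: hfg.
    by exists h, (ga f).
  exact: hclosed (short_exact_ker eK) nK (hGX _ XK).
Qed.

End LeftCotorsion.

(** * The comma category of a right exact functor *)

Section TCommaExact.
Variables (A B : abelian) (T : rightExactFunctor B A).
Let P := Tcomma T.

Lemma TexactP (X Y Z : P) (f : Hom X Y) (g : Hom Y Z) :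
  exact f g <-> exact (ta f) (ta g) /\ exact (tb f) (tb g).
Proof.
split=> [[e he]|[ha hb]].
  have [pa pb] := Tepi he; have ek := ker_liftE e.
  split; [apply: (exact_ker (kermapP (ta g)) pa) | apply: (exact_ker (kermapP (tb g)) pb)].
    exact: (congr1 (@ta _ _ _ _ _) ek).
  exact: (congr1 (@tb _ _ _ _ _) ek).
have e : g ∘ f = 0 by apply: Tmor_eq; apply: exact_comp0.
exists e; have ek := ker_liftE e.
case: ha hb => [ea ha] [eb hb].
have pa : epi (ta (ker_lift e)).
  suff -> : ta (ker_lift e) = ker_lift ea by [].
  apply: (@kermap_mono _ _ _ (ta g)); rewrite ker_liftE.
  exact: (congr1 (@ta _ _ _ _ _) ek).
have pb : epi (tb (ker_lift e)).
  suff -> : tb (ker_lift e) = ker_lift eb by [].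
  apply: (@kermap_mono _ _ _ (tb g)); rewrite ker_liftE.
  exact: (congr1 (@tb _ _ _ _ _) ek).
move=> W u v euv; apply: Tmor_eq.
  by apply: pa; exact: (congr1 (@ta _ _ _ _ _) euv).
by apply: pb; exact: (congr1 (@tb _ _ _ _ _) euv).
Qed.

Lemma Tshort_exactP (X Y Z : P) (f : Hom X Y) (g : Hom Y Z) :
  short_exact (ta f) (ta g) -> short_exact (tb f) (tb g) -> short_exact f g.
Proof. by move=> [? ? ?] [? ? ?]; split; apply/TexactP. Qed.

Definition TprA : functor P A :=
  @Functor P A (@tA A B T) (fun X Y f => ta f)
    (fun X => erefl) (fun X Y Z g f => erefl) (fun X Y f g => erefl).

Definition TprB : functor P B :=
  @Functor P B (@tB A B T) (fun X Y f => tb f)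
    (fun X => erefl) (fun X Y Z g f => erefl) (fun X Y f g => erefl).

Lemma TprA_exact (X Y Z : P) (f : Hom X Y) (g : Hom Y Z) :
  exact f g -> exact (fmap TprA f) (fmap TprA g).
Proof. by case/TexactP. Qed.

Lemma TprB_exact (X Y Z : P) (f : Hom X Y) (g : Hom Y Z) :
  exact f g -> exact (fmap TprB f) (fmap TprB g).
Proof. by case/TexactP. Qed.

Lemma Tiso (X Y : P) (a : Hom (tA X) (tA Y)) (a' : Hom (tA Y) (tA X))
    (b : Hom (tB X) (tB Y)) (b' : Hom (tB Y) (tB X)) :
  a' ∘ a = idm _ -> a ∘ a' = idm _ -> b' ∘ b = idm _ -> b ∘ b' = idm _ ->
  tphi Y ∘ fmap T b = a ∘ tphi X -> isomorphic X Y.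
Proof.
move=> ea ea' eb eb' c.
have c' : tphi X ∘ fmap T b' = a' ∘ tphi Y.
  rewrite -[LHS]comp1m -ea -(compmA a') (compmA a) -c -(compmA (tphi Y)) -fmapM.
  by rewrite eb' fmap1 compm1.
by exists (TMor c), (TMor c'); split; apply: Tmor_eq.
Qed.

(** Test objects of the comma category.  (X, 0) and (0, Y) lie in the class of
    pairs as soon as X, resp. Y, lies in the given class; (T Y, Y) and (X, 0)
    lie in the class B under the same conditions, because their structure maps
    are mono with cokernels 0 and X. *)
Definition Tright (Y : B) : P := @TOb A B T zob Y 0.

Definition Tunit (Y : B) : P := @TOb A B T (T Y) Y (idm (T Y)).

Definition Tleft_ob (X : A) : P := @TOb A B T X zob 0.

Fact Tleft_comm (X Y : A) (f : Hom X Y) :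
  tphi (Tleft_ob Y) ∘ fmap T (0 : Hom zob zob) = f ∘ tphi (Tleft_ob X).
Proof. by rewrite comp0m compm0. Qed.

Definition Tleft : functor A P.
Proof.
refine (@Functor A P Tleft_ob
  (fun X Y f => @TMor A B T (Tleft_ob X) (Tleft_ob Y) f 0 (Tleft_comm f)) _ _ _).
- by move=> X; apply: Tmor_eq => //; apply: (proj1 (@zobP B _)).
- by move=> X Y Z g f; apply: Tmor_eq => //=; rewrite comp0m.
- by move=> X Y f g; apply: Tmor_eq => //=; rewrite addr0.
Defined.

Lemma Tleft_exact (X Y Z : A) (f : Hom X Y) (g : Hom Y Z) :
  exact f g -> exact (fmap Tleft f) (fmap Tleft g).
Proof. by move=> h; apply/TexactP; split=> //; apply/exact_zero/zobP. Qed.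

Fact Tunit_comm (X Y : B) (f : Hom X Y) :
  tphi (Tunit Y) ∘ fmap T f = fmap T f ∘ tphi (Tunit X).
Proof. by rewrite /= comp1m compm1. Qed.

Definition Tunit_map (X Y : B) (f : Hom X Y) : Hom (Tunit X) (Tunit Y) :=
  @TMor A B T (Tunit X) (Tunit Y) (fmap T f) f (Tunit_comm f).

Lemma rfun_exact (X Y Z : B) (f : Hom X Y) (g : Hom Y Z) :
  exact f g -> epi g -> exact (fmap T f) (fmap T g).
Proof. by move=> hfg hg; apply/cokernel_exact/rfun_coker/exact_epi_cokernel. Qed.

Lemma Tunit_short_exact (X Y Z : B) (f : Hom X Y) (g : Hom Y Z) :
  short_exact f g -> mono (fmap T f) -> short_exact (Tunit_map f) (Tunit_map g).
Proof.
move=> hs hf; apply: Tshort_exactP => //.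
have /short_exactP [_ hfg hg] := hs; apply/short_exactP; split=> //.
- exact: rfun_exact.
- exact: rfun_epi.
Qed.

(** An extension of Y by N lifts along the second projection to one of
    (T Y, Y) by (0, N): it is Yoneda equivalent to one all of whose terms but
    the first are projective, and by acyclicity T keeps that part exact. *)
Lemma Tunit_lift (hP : enough_projectives B) k (Y N : B) (e : extension k.+1 Y N) :
  @acyclic (op B) (op A) (op_rfun T) k Y ->
  exists e0 : extension k.+1 (Tunit Y) (Tright N),
    yoneda_equiv (ext_map TprB_exact e0 : extension k.+1 Y N) e.
Proof.
elim: k Y e => [|k IHk] Y [c hc] hY.
  case: c hc => E [a b] hc.
  have [h0 [hab hb]] := hc; rewrite /= in h0 hab hb.
  pose E' : P := @TOb A B T (T Y) E (fmap T b).
  have ca : tphi E' ∘ fmap T a = 0 ∘ tphi (Tright N).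
    by rewrite comp0m -fmapM (exact_comp0 hab) fmap0.
  have cb : tphi (Tunit Y) ∘ fmap T b = idm (T Y) ∘ tphi E' by [].
  pose a' : Hom (Tright N) E' := @TMor A B T (Tright N) E' 0 a ca.
  pose b' : Hom E' (Tunit Y) := @TMor A B T E' (Tunit Y) (idm (T Y)) b cb.
  have hs : exact_chain (existT _ E' (a', b') : @chain P 1 (Tright N) (Tunit Y)).
    split; first by apply/TexactP; split=> //; apply/exact_zero/zobP.
    split; apply/TexactP; split=> //; last exact/epi_exact0/epi_idm.
    exact/mono_exact0/mono_idm.
  exists (exist _ _ hs); apply: yoneda_step; exact: chain_morph_idm.
have [L [E [l [q [d [hs hd ec]]]]]] := unsplice_r (hc : exact_from 0 c).
have [Q [p [hQ hp]]] := hP Y.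
have hk := short_exact_ker hp.
have [mT hK] := hY Q (ker p) p (kermap p) (op_injective hQ)
  (proj1 (short_exact_op _ _) hk).
have /short_exactP [hl hlq hq] := hs; have /short_exactP [_ hkp _] := hk.
have [s es] := hQ _ _ q p hq.
have [|w ew] := exact_factor hlq hl (h := s ∘ kermap p).
  by rewrite compmA es (exact_comp0 hkp).
have [d' [hd' hm]] := pull_chain w hd.
have [e0 he0] := IHk _ (exist _ d' hd') hK.
exists (ext_splice_r (Tunit_short_exact hk mT) e0).
rewrite ext_map_splice_r.
apply: rst_trans (yoneda_splice_r _ he0) _.
by apply: yoneda_step; rewrite ec; apply: hm (esym ew) es.
Qed.

Lemma Tleft_lift k (X M : A) (e : extension k X M) :
  yoneda_equiv (ext_map TprA_exact (ext_map Tleft_exact e) : extension k X M) e.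
Proof.
case: e => c hc; apply: yoneda_step => /=.
have h n (Y Z : A) (d : chain n Y Z) : chain_map TprA (chain_map Tleft d) = d.
  by elim: n Y d => // n IHn Y [V [a d]] /=; have /= -> := IHn V d.
by rewrite h; apply: chain_morph_idm.
Qed.

Lemma Bclass_iso (X : A -> Prop) (Y : B -> Prop) (V W : P) :
  object_class X -> object_class Y -> isomorphic V W ->
  @Bclass A B T X Y V -> @Bclass A B T X Y W.
Proof.
move=> [_ hX] [_ hY] [f [g [e1 e2]]] [yV mV xV].
have a1 : ta g ∘ ta f = idm _ := congr1 (@ta _ _ _ _ _) e1.
have a2 : ta f ∘ ta g = idm _ := congr1 (@ta _ _ _ _ _) e2.
have b1 : tb g ∘ tb f = idm _ := congr1 (@tb _ _ _ _ _) e1.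
have b2 : tb f ∘ tb g = idm _ := congr1 (@tb _ _ _ _ _) e2.
split.
- by apply: hY yV; exists (tb f), (tb g).
- apply: (@mono_of_comp _ _ _ _ (ta g)); rewrite -tcomm; apply: mono_comp mV _.
  apply: (@mono_of_comp _ _ _ _ (fmap T (tb f))); rewrite -fmapM b2 fmap1.
  exact: mono_idm.
- exact: hX (coker_isomorphic a1 a2 (tcomm f) (tcomm g)) xV.
Qed.

(** Dually to the case of D: along a finite coresolution by objects of the
    class B the functor T is exact on second components, the structure maps
    stay mono, and their cokernels form a coresolution. *)
Lemma vee_Bclass (hP : enough_projectives B) n (X : A -> Prop) (Y : B -> Prop)
    k (W : P) :
  object_class X -> object_class Y ->
  (forall y, Y y -> @acyclic (op B) (op A) (op_rfun T) n y) ->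
  (k < n)%N -> vee (@Bclass A B T X Y) k W ->
  [/\ @acyclic (op B) (op A) (op_rfun T) (n - k) (tB W), mono (tphi W)
    & vee X k (coker (tphi W))].
Proof.
move=> hX hY hac; elim: k W => [|k IHk] W hk.
  case/vee_inv=> [[D [hD hDW]]|[m [? [? [? [? []]]]]]] //.
  have [yW mW xW] := Bclass_iso hX hY hDW hD.
  by split; [rewrite subn0; apply: hac | | apply: vee_base].
case/vee_inv=> [[D [hD hDW]]|[m [K [D [f [g [[<-] hs [yD mD xD] hK]]]]]]].
  have [yW mW xW] := Bclass_iso hX hY hDW hD.
  by split; [apply: acyclic_le (leq_subr _ _) (hac _ yW) | | apply: vee_base].
have [aK mK xK] := IHk _ (ltnW hk) hK.
have hI := op_enough_injectives hP.
have hsA := functor_short_exact TprA_exact hs.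
have hsB := functor_short_exact TprB_exact hs.
have hsB' := proj1 (short_exact_op _ _) hsB.
have enk : (n - k = (n - k.+1).+1)%N by rewrite subnSK // ltnW.
rewrite enk in aK.
have aD := acyclic_le (leq_subr k.+1 n) (hac _ yD).
have aW := acyclic_quotient hI hsB' aK aD.
have mTf : mono (fmap T (tb f)) := acyclic_epi hI aK hsB'.
have /short_exactP [_ hfg hg] := hsB.
split=> //.
  by apply: (@mono_of_comp _ _ _ _ (ta f)); rewrite -tcomm; apply: mono_comp.
have [u [v huv]] := coker_short_exact (rfun_exact hfg hg) (rfun_epi hg) hsA
  (esym (tcomm f)) (esym (tcomm g)) mK.
exact: vee_step huv xD xK.
Qed.

End TCommaExact.

(** * Right cotorsion pairs *)

Section RightCotorsion.
Variables (A B : abelian) (hP : enough_projectives B) (T : rightExactFunctor B A).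
Variables (X M : A -> Prop) (Y N : B -> Prop) (n : nat).
Hypotheses (hX : object_class X) (hM : object_class M)
  (hY : object_class Y) (hN : object_class N).
Hypothesis hn : (1 <= n)%N.
Hypothesis hpair :
  hereditary_right_cotorsion_pair n (@Bclass A B T X Y) (@Tpair_class A B T M N).
Hypothesis hac : forall y, Y y -> @acyclic (op B) (op A) (op_rfun T) n y.

Lemma right_ext_zero i (W V : Tcomma T) : (1 <= i <= n.+1)%N ->
  Bclass X Y W -> Tpair_class M N V -> ext_zero i W V.
Proof.
case: hpair => -[_ hext _] her /andP [i1]; rewrite leq_eqVlt => /orP [/eqP ->|].
  exact: her.
by rewrite ltnS => i2; apply: hext; rewrite i1.
Qed.

(** Ext descends along the second projection from the objects (T Y, Y) and
    (0, N) by the lifting of extensions, and an approximation of (0, b)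
    projects to one of b. *)
Lemma right_pairB : hereditary_right_cotorsion_pair n Y N.
Proof.
have hext i y m : (1 <= i <= n.+1)%N -> Y y -> N m -> ext_zero i y m.
  case: i => // i hi hy hm.
  have hz : ext_zero i.+1 (Tunit T y) (Tright T m).
    apply: right_ext_zero => //; last by split=> //; case: hM.
    split=> //; first exact: mono_idm.
    case: hX => hX0; apply=> //; last exact: hX0.
    by apply: zero_isomorphic; [exact: zobP | apply/epi_coker_zero/epi_idm].
  have := ext_zero_map (F_exact := @TprB_exact A B T) hz; apply=> e.
  exact: (@Tunit_lift A B T hP i y m e (acyclic_le (hi : (i <= n)%N) (hac hy))).
case: hpair => -[hsum _ happ] _.
split; last by move=> y m; apply: hext; rewrite leqnn.
split.
- move=> y y' z hz [f [g [e1 e2]]].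
  suff : Tpair_class M N (Tright T y) by case.
  apply: (hsum _ (Tright T y') (Tright T z)); first by split=> //; case: hM.
  have [|a [a' [a1 a2]]] := @zero_isomorphic A zob (bip zob zob) (@zobP A).
    by apply: is_zero_bip; apply: zobP.
  apply: (@Tiso A B T (Tright T z) (bip (Tright T y) (Tright T y')) a a' f g) => //.
  exact: (proj2 (is_zero_bip (@zobP A) (@zobP A) _)).
- by move=> i y m /andP [i1 i2]; apply: hext; rewrite i1 ltnW.
- move=> b; have [D [K [f [g [hs [_ hD] hK]]]]] := happ (Tright T b).
  exists (tB D), (tB K), (tb f), (tb g); split=> //.
    exact: (functor_short_exact (@TprB_exact A B T) hs).
  by apply: (vee_map (@TprB_exact A B T) _ hK) => W [].
Qed.

(** Everything is tested on objects (X, 0).  In an approximation of (a, 0) with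
    cokernel K, the second component of K is isomorphic to that of the middle
    term, hence in the class N; the structure map of K exhibits its first
    component as an extension of a cokernel coresolved by vee_Bclass by an
    object coresolved by assumption. *)
Lemma right_pairA : extension_closed (vee X n.-1) ->
  (forall y, N y -> vee X n.-1 (T y)) -> hereditary_right_cotorsion_pair n X M.
Proof.
move=> hclosed hTN.
have hext i x m : (1 <= i <= n.+1)%N -> X x -> M m -> ext_zero i x m.
  move=> hi hx hm.
  have hz : ext_zero i (Tleft T x) (Tleft T m).
    apply: right_ext_zero => //; last by split=> //; case: hN.
    split; first by case: hY.
      by apply/zero_mono/functor_zero/zobP.
    by case: hX => _; apply; [apply: coker0_isomorphic | exact: hx].
  have := ext_zero_map (F_exact := @TprA_exact A B T) hz; apply=> e.
  by exists (ext_map (@Tleft_exact A B T) e); apply: Tleft_lift.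
case: hpair => -[hsum _ happ] _.
split; last by move=> x m; apply: hext; rewrite leqnn.
split.
- move=> x x' z hz [f [g [e1 e2]]].
  suff : Tpair_class M N (Tleft T x) by case.
  apply: (hsum _ (Tleft T x') (Tleft T z)); first by split=> //; case: hN.
  have [|b [b' [b1 b2]]] := @zero_isomorphic B zob (bip zob zob) (@zobP B).
    by apply: is_zero_bip; apply: zobP.
  apply: (@Tiso A B T (Tleft T z) (bip (Tleft T x) (Tleft T x')) f g b b') => //.
  exact: (proj1 (functor_zero T (@zobP B) _)).
- by move=> i x m /andP [i1 i2]; apply: hext; rewrite i1 ltnW.
- move=> a; have [D [K [f [g [hs [hDM hDN] hK]]]]] := happ (Tleft T a).
  have hsA := functor_short_exact (@TprA_exact A B T) hs.
  have hsB := functor_short_exact (@TprB_exact A B T) hs.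
  exists (tA D), (tA K), (ta f), (ta g); split=> //.
  have hn1 : (n.-1 < n)%N by rewrite prednK.
  have [_ mK xK] := vee_Bclass hP hX hY hac hn1 hK.
  have NK : N (tB K).
    case: hN => _; apply; last exact: hDN.
    have /short_exactP [_ hfg hg] := hsB.
    (* the second component of (a, 0) vanishes, so tb g is an isomorphism *)
    have [|h [e1 e2]] := mono_epi_iso (f := tb g) _ hg.
      apply: exact0_mono; rewrite -(zero_homl (tb f) (@zobP B)); exact: hfg.
    by exists (tb g), h.
  exact: hclosed (short_exact_coker mK) (hTN _ NK) xK.
Qed.

End RightCotorsion.

(** * The transfer theorem *)

Theorem proposition3p17 (A B : abelian)
    (hpA : enough_projectives A) (hiA : enough_injectives A)
    (hpB : enough_projectives B) (hiB : enough_injectives B)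
    (T : rightExactFunctor B A) (G : leftExactFunctor A B)
    (X M : A -> Prop) (Y N : B -> Prop)
    (hX : object_class X) (hM : object_class M)
    (hY : object_class Y) (hN : object_class N)
    (n : nat) (hn : (1 <= n)%N) :
  (* (1) *)
  (hereditary_left_cotorsion_pair n (@Gpair_class A B G X Y) (@Dclass A B G M N) ->
    (* (a) *)
    ((forall (j : nat) (m : A), (1 <= j <= n)%N -> M m ->
        is_zero (right_derived hiA G j m)) ->
     hereditary_left_cotorsion_pair n X M) /\
    (* (b) *)
    ((forall (j : nat) (m : A), (1 <= j <= n)%N -> M m ->
        is_zero (right_derived hiA G j m)) ->
     extension_closed (wedge N n.-1) ->
     (forall x : A, X x -> wedge N n.-1 (G x)) ->
     hereditary_left_cotorsion_pair n Y N)) /\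
  (* (2) *)
  (hereditary_right_cotorsion_pair n (@Bclass A B T X Y) (@Tpair_class A B T M N) ->
    (* (a) *)
    ((forall (j : nat) (y : B), (1 <= j <= n)%N -> Y y ->
        is_zero (left_derived hpB T j y)) ->
     hereditary_right_cotorsion_pair n Y N) /\
    (* (b) *)
    ((forall (j : nat) (y : B), (1 <= j <= n)%N -> Y y ->
        is_zero (left_derived hpB T j y)) ->
     extension_closed (vee X n.-1) ->
     (forall y : B, N y -> vee X n.-1 (T y)) ->
     hereditary_right_cotorsion_pair n X M)).
Proof.
split=> hpair.
  split=> [hR|hR hcl hGX].
  - apply: (left_pairA hiA hY hN hpair) => m hm.
    by apply: (right_derived_acyclic (hI := hiA)) => j hj; apply: hR.
  - apply: (left_pairB hiA hX hM hN hn hpair _ hcl hGX) => m hm.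
    by apply: (right_derived_acyclic (hI := hiA)) => j hj; apply: hR.
split=> [hL|hL hcl hTN].
- apply: (right_pairB hpB hX hM hpair) => y hy.
  by apply: (left_derived_acyclic (hP := hpB)) => j hj; apply: hL.
- apply: (right_pairA hpB hX hY hN hn hpair _ hcl hTN) => y hy.
  by apply: (left_derived_acyclic (hP := hpB)) => j hj; apply: hL.
Qed.
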